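(* Let $U\subset\mathbb{R}^n$ be a smoothly bounded strictly convex domain, let $\alpha\in(0,1]$, and let $u_0,u_1\in\tilde{\mathcal S}^{1,\alpha}$. Let $u\in C(\overline{U\times(0,1)})$, convex in $U\times(0,1)$, be the solution of the Dirichlet problem $$\det(D^2_{x,t}u)=0\ \text{in } U\times(0,1),\quad u=u_0\ \text{on } U\times\{0\},\quad u=u_1\ \text{on } U\times\{1\},\quad u=0\ \text{on } \partial U\times(0,1).$$ Then $u\in C^{1,\alpha}_{loc}(U\times(0,1))$. Moreover, a blow-up of the $C^{1,\alpha}$ norm of $u$ is only possible at the corners $\partial U\times\{0,1\}$: for every neighborhood $W$ of $\partial U\times\{0,1\}$, the $C^{1,\alpha}$ norm of $u$ on $(U\times(0,1))\setminus W$ is finite.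
   Context: A convex function $u$ on a convex domain $U\subset\mathbb{R}^n$ is called strictly convex at $y\in U$ if for some affine support function $l_y$ of $u$ at $y$ (i.e. $l_y$ affine, $u\ge l_y$ on $U$, $u(y)=l_y(y)$) one has $\{x\in U: u(x)=l_y(x)\}=\{y\}$; $u$ is strictly convex if it is strictly convex at every $y\in U$. The space $\tilde{\mathcal S}^{1,\alpha}$ is $$\tilde{\mathcal S}^{1,\alpha}:=\{u\in C^{1,\alpha}(U)\cap C(\overline U)\ |\ u \text{ strictly convex on } U,\ \|u\|_{C^1}<\infty,\ u=0\text{ on }\partial U\},$$ where $u\in C^{1,\alpha}(U)$ means that $u$ is $C^1$ on $U$ with $Du$ $\alpha$-Hölder continuous on $U$ (finite $C^{1,\alpha}$ norm over $U$). $D^2_{x,t}u$ is the Hessian in the joint variables $(x,t)$. The equation $\det(D^2_{x,t}u)=0$ is understood in the generalized (Alexandrov) sense for convex functions; the convex generalized solution $u$ exists and is unique. *)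

(* Defs.v *)
From mathcomp Require Import all_boot all_order all_algebra.
From mathcomp Require Import all_classical all_reals all_analysis.

Set Implicit Arguments.
Unset Strict Implicit.
Unset Printing Implicit Defensive.

Import Order.TTheory GRing.Theory Num.Theory.
Import numFieldNormedType.Exports.

Local Open Scope classical_set_scope.
Local Open Scope ring_scope.

(* R^n is 'rV[R]_n, which the library norms by the maximum of the absolute
   values of the coordinates. All metric notions below (boundedness, finiteness
   of a C^1 or C^{1,a} norm) are the same for any other norm. *)

Section Euclidean.
Context {R : realType} {n : nat}.
Implicit Types (f u l : 'rV[R]_n -> R) (U A E : set 'rV[R]_n).

Definition dot (p x : 'rV[R]_n) : R := \sum_(i < n) p 0 i * x 0 i.

Definition bdry A : set 'rV[R]_n := closure A `\` interior A.

Definition grad f (x : 'rV[R]_n) : 'rV[R]_n :=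
  \row_i 'D_(delta_mx 0 i) f x.

Definition iter_partial f (s : seq 'I_n) : 'rV[R]_n -> R :=
  foldr (fun i g => 'D_(delta_mx 0 i) g) f s.

(* For V open this is f \in C^oo(V): differentiability of every iterated partial
   derivative yields the continuity of all of them. *)
Definition smooth_on (V : set 'rV[R]_n) f : Prop :=
  forall (s : seq 'I_n) x, V x -> differentiable (iter_partial f s) x.

Definition smooth_boundary U : Prop :=
  forall y, bdry U y ->
    exists (V : set 'rV[R]_n) (rho : 'rV[R]_n -> R),
      [/\ open V /\ V y, smooth_on V rho,
          (forall x, V x -> rho x = 0 -> grad rho x != 0) &
          U `&` V = [set x | V x /\ rho x < 0]].

Definition strictly_convex_domain U : Prop :=
  [/\ U !=set0, open U, convex_set U &
      forall x y (t : R), closure U x -> closure U y -> x != y ->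
        0 < t < 1 -> U (t *: x + (1 - t) *: y)].

Definition smoothly_bounded U : Prop := bounded_set U /\ smooth_boundary U.

Definition affine l : Prop :=
  exists (p : 'rV[R]_n) (c : R), forall x, l x = dot p x + c.

Definition affine_support U u (y : 'rV[R]_n) l : Prop :=
  [/\ affine l, (forall x, U x -> l x <= u x) & u y = l y].

Definition strictly_convex_at U u (y : 'rV[R]_n) : Prop :=
  exists l, affine_support U u y l /\ [set x | U x /\ u x = l x] = [set y].

Definition strictly_convex_on U u : Prop :=
  convex_function U u /\ forall y, U y -> strictly_convex_at U u y.

Definition C1_on U f : Prop :=
  forall x, U x -> differentiable f x /\ {for x, continuous (grad f)}.

Definition C1_norm f E : \bar R :=
  (ereal_sup [set (@Num.norm R R (f x))%:E | x in E] +
   ereal_sup [set `|grad f x|%:E | x in E])%E.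

(* The diagonal pairs of E `*` E contribute 0 / 0 = 0 to the supremum. *)
Definition grad_holder_seminorm (a : R) f E : \bar R :=
  ereal_sup [set (`|grad f p.1 - grad f p.2| / (`|p.1 - p.2| `^ a))%:E |
             p in E `*` E].

(* If E is empty, the suprema, hence the norm, are -oo; otherwise they are
   nonnegative. *)
Definition C1a_norm (a : R) f E : \bar R :=
  (C1_norm f E + grad_holder_seminorm a f E)%E.

Definition C1a_on (a : R) U f : Prop :=
  C1_on U f /\ (C1a_norm a f U < +oo)%E.

Definition C1a_loc (a : R) U f : Prop :=
  C1_on U f /\
  forall K : set 'rV[R]_n, compact K -> K `<=` U -> (C1a_norm a f K < +oo)%E.

Definition S_tilde (a : R) U u : Prop :=
  [/\ C1a_on a U u, {within closure U, continuous u}, strictly_convex_on U u,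
      (C1_norm u U < +oo)%E & forall x, bdry U x -> u x = 0].

(* The (outer) Lebesgue measure on R^n, by countable covers by boxes. *)
Definition box (a b : 'rV[R]_n) : set 'rV[R]_n :=
  [set x | forall i, a 0 i <= x 0 i <= b 0 i].

Definition box_volume (a b : 'rV[R]_n) : R := \prod_(i < n) (b 0 i - a 0 i).

Definition lebesgue_outer A : \bar R :=
  ereal_inf [set (\sum_(0 <= k <oo) (box_volume (c k).1 (c k).2)%:E)%E |
    c in [set c : nat -> 'rV[R]_n * 'rV[R]_n |
      (forall k i, (c k).1 0 i <= (c k).2 0 i) /\
      A `<=` \bigcup_k box (c k).1 (c k).2]].

Definition subdifferential U u (x : 'rV[R]_n) : set 'rV[R]_n :=
  [set p | forall y, U y -> u x + dot p (y - x) <= u y].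

(* For u convex on U open and E Borel, the union below is Lebesgue measurable,
   so that the outer measure is its measure. *)
Definition monge_ampere_measure U u E : \bar R :=
  lebesgue_outer (\bigcup_(x in E) subdifferential U u x).

Definition borel E : Prop := <<s [set O : set 'rV[R]_n | open O] >> E.

(* det (D^2 u) = 0 in U in the sense of Alexandrov. *)
Definition alexandrov_det_hessian_eq0 U u : Prop :=
  forall E, borel E -> E `<=` U -> monge_ampere_measure U u E = 0%E.

End Euclidean.

Section SpaceTime.
Context {R : realType} {n : nat}.

(* The point (x, t) of R^n x R = R^(n+1), and the product A x I. *)
Definition xt (x : 'rV[R]_n) (t : R) : 'rV[R]_(n + 1) := row_mx x (const_mx t).

Definition cyl (A : set 'rV[R]_n) (I : set R) : set 'rV[R]_(n + 1) :=
  [set z | A (lsubmx z) /\ I (rsubmx z 0 0)].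

Definition unit_cyl (A : set 'rV[R]_n) : set 'rV[R]_(n + 1) :=
  cyl A `]0, 1[%classic.

Definition dirichlet_solution (U : set 'rV[R]_n) (u0 u1 : 'rV[R]_n -> R)
    (u : 'rV[R]_(n + 1) -> R) : Prop :=
  let Q := unit_cyl U in
  [/\ {within closure Q, continuous u}, convex_function Q u,
      alexandrov_det_hessian_eq0 Q u,
      (forall x, U x -> u (xt x 0) = u0 x /\ u (xt x 1) = u1 x) &
      (forall x (t : R), bdry U x -> 0 < t < 1 -> u (xt x t) = 0)].

End SpaceTime.

(* Main.v *)
(* The solution is u(x, t) = min { (1 - t) u0(x0) + t u1(x1) | x = (1 - t) x0 + t x1 }.
   Indeed, a Lagrange multiplier for a minimiser (x0, x1) yields an affine function l
   below u0 at t = 0 and below u1 at t = 1, touching them at x0 and x1. A maximum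
   principle for the Alexandrov equation (if l exceeded u somewhere, the subdifferential
   of u would contain a cube of slopes, and a cube is not Lebesgue null) gives l <= u,
   and convexity gives equality at (x, t).

   It remains to bound u - l by C |h|^(1 + alpha) at distance h from (x, t), uniformly
   away from the corners. Let d be the larger of the distances of x0 and x1 to the
   boundary of U, attained at x1 say.
   - If |h| << d, move x1 only and use the regularity of u1.
   - If d << |h|, then -l(b0, 0), -l(b1, 1) = O(d^(1 + alpha)) for the boundary points b0, b1
     next to x0, x1, hence the t-slope of l and the gap u1 - l at (b0, 1) are of that order
     too. By convexity and C^(1, alpha) regularity, so is u1 - l at distance O(d) from x, with
     a gradient O(d^alpha), so that u1 - l = O(|h|^(1 + alpha)) at distance |h|; now join
     a boundary point, where u = 0, to a point at time 1.
   Near t = 0 or t = 1 and away from the boundary of U, the first case alone suffices.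
   For the convex function u this bound is equivalent to the Hoelder bound on its
   gradient. *)
Require Import Defs.
From mathcomp Require Import all_boot all_order all_algebra.
From mathcomp Require Import all_classical all_reals all_analysis.
From HB Require Import structures.
From mathcomp Require Import ring lra.
Import Order.TTheory GRing.Theory Num.Theory.
Import numFieldNormedType.Exports.
Local Open Scope classical_set_scope.
Local Open Scope ring_scope.

(** No nearest boundary points are used: from a fixed centre [o] every point is [seg lam b o] with
    [b] on the boundary. The ball of radius [lam * r0] about it lies in [U], and [b] is at distance
    at most [lam * D], so [lam] measures both the room around the point and its distance to the
    boundary.

    The obstacle is that a minimiser may have one endpoint on the boundary, where no gradient is
    available. Both cannot lie there, since the data are negative inside; the multiplier is read off
    an interior endpoint, and time reversal reduces to the case where [x1] is the deeper one. The
    gap between [f1] and the plane is small at the boundary point [b0], but a gradient bound needs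
    room, so it is taken at [seg t b0 x1], whose room is proportional to [t * lam1]. This and the
    divisions by [s] produce the constants that degenerate at small times.

    The estimates concern only the two data and the plane: explicit chords between the data give the
    upper bounds, and [u] enters only once these are available. *)

Section RowVectors.
Context {R : realType} {n : nat}.
Implicit Types (p q x y : 'rV[R]_n) (f : 'rV[R]_n -> R).

Lemma coord_le_norm x i : `|x 0 i| <= `|x|.
Proof.
rewrite [leRHS]/Num.norm /= mx_normrE.
by rewrite (le_bigmax _ (fun ij : 'I_1 * 'I_n => `|x ij.1 ij.2|) (0, i)).
Qed.

Lemma norm_row_le x (c : R) : 0 <= c -> (forall i, `|x 0 i| <= c) -> `|x| <= c.
Proof.
move=> c0 h; rewrite [leLHS]/Num.norm /= mx_normrE; apply/bigmax_leP; split=> //.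
by move=> [a i] _ /=; rewrite (ord1 a).
Qed.

Lemma norm_le_sub x y : `|x| <= `|x - y| + `|y|.
Proof. by rewrite -[in leLHS](subrK y x) ler_normD. Qed.

Lemma norm_sub_le x y : `|x - y| <= `|x| + `|y|.
Proof. exact: ler_normB. Qed.

Lemma norm_sub_trans x y z : `|x - z| <= `|x - y| + `|y - z|.
Proof. exact: ler_distD. Qed.

Lemma norm_delta_le (i : 'I_n) : `|delta_mx 0 i : 'rV[R]_n| <= 1.
Proof.
apply: norm_row_le => // j; rewrite mxE eqxx /=.
by case: (j == i); rewrite ?normr1 ?normr0.
Qed.

Lemma dotDr p x y : dot p (x + y) = dot p x + dot p y.
Proof.
by rewrite /dot -big_split; apply: eq_bigr => i _; rewrite mxE mulrDr.
Qed.

Lemma dotZr p (k : R) x : dot p (k *: x) = k * dot p x.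
Proof.
by rewrite /dot mulr_sumr; apply: eq_bigr => i _; rewrite mxE; ring.
Qed.

Lemma dotNr p x : dot p (- x) = - dot p x.
Proof. by rewrite -scaleN1r dotZr mulN1r. Qed.

Lemma dotBr p x y : dot p (x - y) = dot p x - dot p y.
Proof. by rewrite dotDr dotNr. Qed.

Lemma dotC p q : dot p q = dot q p.
Proof. by apply: eq_bigr => i _; rewrite mulrC. Qed.

Lemma dotBl p q x : dot (p - q) x = dot p x - dot q x.
Proof. by rewrite !(dotC _ x) dotBr. Qed.

Lemma dotNl p x : dot (- p) x = - dot p x.
Proof. by rewrite !(dotC _ x) dotNr. Qed.

Lemma dot_delta p (i : 'I_n) : dot p (delta_mx 0 i) = p 0 i.
Proof.
rewrite /dot (bigD1 i) //= mxE !eqxx mulr1 big1 ?addr0 // => j ji.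
by rewrite mxE (negbTE ji) mulr0.
Qed.

Lemma dot_le p x : dot p x <= n%:R * `|p| * `|x|.
Proof.
rewrite /dot -mulrA mulr_natl -[X in _ *+ X](card_ord n) -sumr_const.
apply: ler_sum => i _; apply: le_trans (ler_norm _) _.
by rewrite normrM ler_pM ?coord_le_norm.
Qed.

Lemma dot_ge p x : - (n%:R * `|p| * `|x|) <= dot p x.
Proof. by rewrite lerNl -dotNr; apply: le_trans (dot_le _ _) _; rewrite normrN. Qed.

Lemma norm_dot_le p x : `|dot p x| <= n%:R * `|p| * `|x|.
Proof. by rewrite ler_norml dot_ge dot_le. Qed.

Lemma continuous_dot p : continuous (dot p).
Proof.
apply: continuous_big => [? | i _ y]; first exact: add_continuous.
apply: (@cvgMl_tmp R _ (nbhs y) _ (fun z : 'rV[R]_n => z 0 i) (p 0 i)).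
exact: (@coord_continuous R 1 n 0 i y).
Qed.

End RowVectors.

(** * Cubes have positive outer measure *)

Section CubeMeasure.
Context {R : realType}.

(* Clamped to [a, b + h], the points p + j h with a <= p + j h <= b advance by
   exactly h. *)
Lemma count_grid_le (a b p h : R) (m : nat) : 0 < h -> a <= b ->
  \sum_(j < m) (a <= p + j%:R * h <= b)%R%:R <= (b - a) / h + 1.
Proof.
move=> h0 ab; pose cl (x : R) := Num.max a (Num.min x (b + h)).
pose F (j : nat) := cl (p + j%:R * h).
have clE x : [\/ x <= a /\ cl x = a, a <= x <= b + h /\ cl x = x |
    b + h <= x /\ cl x = b + h].
  rewrite /cl; case: (leP x (b + h)) => xb.
    case: (leP a x) => ax; first by apply: Or32.
    by apply: Or31; split=> //; exact: ltW.
  case: (leP a (b + h)) => ah; first by apply: Or33; split=> //; exact: ltW.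
  by exfalso; lra.
have step (j : nat) : h * (a <= p + j%:R * h <= b)%R%:R <= F j.+1 - F j.
  rewrite /F -natr1 mulrDl mul1r addrA.
  move: (p + j%:R * h) => x.
  case: andP => [[ax xb]|_]; rewrite ?mulr1 ?mulr0;
    by case: (clE x) => -[? ->]; case: (clE (x + h)) => -[? ->]; lra.
rewrite -(ler_pM2l h0) mulr_sumr.
apply: (le_trans (ler_sum _ (fun (j : 'I_m) _ => step j))).
rewrite -(big_mkord xpredT (fun j => F j.+1 - F j)) telescope_sumr // mulrDr mulr1.
have -> : h * ((b - a) / h) = b - a by field; rewrite gt_eqF.
have cle x : a <= cl x <= b + h.
  by case: (clE x) => -[? ->]; lra.
by have := cle (p + m%:R * h); have := cle (p + 0%:R * h); rewrite /F; lra.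
Qed.

Context {n : nat}.
Implicit Types (a b p : 'rV[R]_n) (A : set 'rV[R]_n).

(** The indicator of a box is the product of its coordinate indicators, so the sum over all grid
    points factors into one-dimensional counts. *)
Lemma count_grid_box_le a b p (h : R) (m : nat) : 0 < h ->
  (forall i, a 0 i <= b 0 i) ->
  \sum_(g : {ffun 'I_n -> 'I_m})
     [forall i, a 0 i <= p 0 i + (g i)%:R * h <= b 0 i]%R%:R <=
  \prod_(i < n) ((b 0 i - a 0 i) / h + 1).
Proof.
move=> h0 ab.
have -> : \sum_(g : {ffun 'I_n -> 'I_m})
    [forall i, a 0 i <= p 0 i + (g i)%:R * h <= b 0 i]%R%:R =
    \sum_(g : {ffun 'I_n -> 'I_m})
      \prod_i (a 0 i <= p 0 i + (g i)%:R * h <= b 0 i)%R%:R :> R.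
  apply: eq_bigr => g _; case: forallP => [gP|gP].
    by rewrite big1 // => i _; rewrite gP.
  have /existsP[i /negbTE gi] : [exists i, ~~ (a 0 i <= p 0 i + (g i)%:R * h <= b 0 i)].
    by rewrite -negb_forall; apply/negP => /forallP.
  by rewrite (bigD1 i) //= gi mul0r.
rewrite -(bigA_distr_bigA (fun i (j : 'I_m) =>
  (a 0 i <= p 0 i + j%:R * h <= b 0 i)%R%:R)).
apply: ler_prod => i _; rewrite sumr_ge0 /=; last by move=> *; exact: ler0n.
exact: count_grid_le.
Qed.

(** A side grows by [3 d]: [2 d] for widening the box at both ends, and [d] for the mesh of the grid
    that is counted in it. *)
Lemma prod_enlarge (L : 'I_n -> R) (e : R) : 0 < e ->
  exists2 d : R, 0 < d & \prod_i (L i + d *+ 3) <= \prod_i L i + e.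
Proof.
move=> e0.
have cont : continuous (fun d : R => \prod_i (L i + d *+ 3)).
  apply: continuous_big => [?|i _ d]; first exact: mul_continuous.
  apply: cvgD; first exact: cvg_cst.
  by apply: cvgMn; exact: cvg_id.
have /nbhs_ballP[d /= d0 dP] :
    \forall d \near (0 : R), \prod_i (L i + d *+ 3) < \prod_i L i + e.
  have := cvgr_lt _ (cont 0); apply.
  by under eq_bigr do rewrite mul0rn addr0; rewrite ltrDl.
exists (d / 2); first by rewrite divr_gt0.
apply/ltW/dP; rewrite -ball_normE /= sub0r normrN gtr0_norm; lra.
Qed.

(** Counting replaces additivity of the measure: each of the [m ^ n] grid points of the cube lies in
    a widened box, each box holds about volume over [h ^ n] of them, and multiplying by [h ^ n]
    compares the volumes. *)
Lemma cube_cover_le p (r : R) (K : nat) (a b : nat -> 'rV[R]_n) (d : nat -> R) :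
  0 < r -> (forall k, 0 < d k) -> (forall k i, a k 0 i <= b k 0 i) ->
  (forall y : 'rV[R]_n, (forall i, p 0 i <= y 0 i <= p 0 i + r) ->
    exists2 k, (k < K)%N & forall i, a k 0 i - d k <= y 0 i <= b k 0 i + d k) ->
  r ^+ n <= \sum_(k < K) \prod_(i < n) (b k 0 i - a k 0 i + d k *+ 3).
Proof.
move=> r0 d0 ab cov.
have [e e0 ed] : exists2 e : R, 0 < e & forall k, (k < K)%N -> e <= d k.
  elim: K {cov} => [|K [e e0 ed]]; first by exists 1.
  exists (Num.min e (d K)); first by rewrite lt_min e0 d0.
  move=> k; rewrite ltnS leq_eqVlt => /orP[/eqP ->|/ed ek].
    by rewrite ge_min lexx orbT.
  by rewrite ge_min ek.
(* With this many points per side, the mesh [h = r / m] is at most [e], hence at most every [d k]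
   with [k < K]. *)
pose m := (Num.truncn (r / e)).+1.
have m0 : 0 < m%:R :> R by rewrite ltr0n.
pose h := r / m%:R.
have h0 : 0 < h by rewrite divr_gt0.
have he : h <= e.
  rewrite /h ler_pdivrMr // -ler_pdivrMl // mulrC; apply: ltW.
  exact: truncnS_gt.
pose a' k : 'rV[R]_n := \row_i (a k 0 i - d k).
pose b' k : 'rV[R]_n := \row_i (b k 0 i + d k).
pose P k (g : {ffun 'I_n -> 'I_m}) :=
  [forall i, a' k 0 i <= p 0 i + (g i)%:R * h <= b' k 0 i].
have hm : h ^+ n * m%:R ^+ n = r ^+ n.
  by rewrite -exprMn /h divfK // gt_eqF.
have count : m%:R ^+ n <= \sum_(k < K) \sum_(g : {ffun 'I_n -> 'I_m}) (P k g)%:R :> R.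
  rewrite exchange_big /=.
  have -> : m%:R ^+ n = \sum_(g : {ffun 'I_n -> 'I_m}) 1 :> R.
    by rewrite sumr_const card_ffun !card_ord natrX.
  apply: ler_sum => g _.
  have [|k kK kP] := cov (\row_i (p 0 i + (g i)%:R * h)).
    move=> i; rewrite mxE; have := ltn_ord (g i).
    rewrite -(ltr_nat R) => gm; apply/andP; split.
      by rewrite lerDl mulr_ge0 // ltW.
    by rewrite lerD2l /h mulrCA ger_pMr // ler_pdivrMr // mul1r ltW.
  rewrite (bigD1 (Ordinal kK)) //= (_ : P k g) /=.
    by rewrite lerDl sumr_ge0 // => *; exact: ler0n.
  by apply/forallP => i; have := kP i; rewrite !mxE.
rewrite -hm; apply: (le_trans (ler_wpM2l _ count)); first by rewrite exprn_ge0 ?ltW.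
rewrite mulr_sumr; apply: ler_sum => k _.
have abk i : a' k 0 i <= b' k 0 i.
  by rewrite !mxE; have := ab k i; have := d0 k; lra.
apply: (le_trans (ler_wpM2l _ (count_grid_box_le _ _ p h m h0 abk))).
  by rewrite exprn_ge0 ?ltW.
have -> : h ^+ n = \prod_(i < n) h by rewrite prodr_const card_ord.
rewrite -big_split /=; apply: ler_prod => i _.
have -> : h * ((b' k 0 i - a' k 0 i) / h + 1) = b' k 0 i - a' k 0 i + h.
  by field; rewrite gt_eqF.
have := abk i; rewrite !mxE => abi; have := ed _ (ltn_ord k).
have := he; have := h0; move: abi; rewrite !mulrS mulr0n; lra.
Qed.

Lemma lebesgue_outer_cube_neq0 p (r : R) A : 0 < r ->
  (forall y : 'rV[R]_n, (forall i, p 0 i <= y 0 i <= p 0 i + r) -> A y) ->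
  lebesgue_outer A <> 0%E.
Proof.
move=> r0 subA A0.
have rn0 : 0 < r ^+ n by rewrite exprn_gt0.
have : (lebesgue_outer A < (r ^+ n / 2)%:E)%E by rewrite A0 lte_fin divr_gt0.
rewrite /lebesgue_outer => /ereal_inf_lt[_ [c [cle cA] <-]] csum.
pose v k := box_volume (c k).1 (c k).2.
have v0 k : 0 <= v k.
  by rewrite /v /box_volume prodr_ge0 // => i _; rewrite subr_ge0.
pose e : R := r ^+ n / 2.
have e0 : 0 < e by rewrite divr_gt0.
have ek0 (k : nat) : 0 < e / (2 ^ k.+1)%:R by rewrite divr_gt0 // ltr0n expn_gt0.
(* The boxes are widened so that their interiors cover the compact cube. The [k]-th one may cost
   [e / 2 ^ (k + 1)], in total [e = r ^ n / 2]; the given cover costs less than [r ^ n / 2], so the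
   sum stays below [r ^ n]. *)
have /choice[d dP] (k : nat) : exists d : R, 0 < d /\
    \prod_i ((c k).2 0 i - (c k).1 0 i + d *+ 3) <= v k + e / (2 ^ k.+1)%:R.
  have [d d0 dP] := prod_enlarge (fun i => (c k).2 0 i - (c k).1 0 i) _ (ek0 k).
  by exists d.
pose K : set 'rV[R]_n := [set y | forall i, `[p 0 i, p 0 i + r]%classic (y ord0 i)].
have cK : compact K.
  apply: (@rV_compact R n (fun i => `[p 0 i, p 0 i + r]%classic)) => i.
  exact: segment_compact.
pose O k : set 'rV[R]_n :=
  [set y | forall i, (c k).1 0 i - d k <= y 0 i <= (c k).2 0 i + d k].
move: cK; rewrite compact_cover => /(_ nat setT (fun k => interior (O k)) (fun k _ => open_interior _)) [].
  move=> y yK; have [|k _ kP] := cA y.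
    apply: subA => i; have := yK i.
    by rewrite /= in_itv.
  exists k => //; apply/nbhs_ballP; exists (d k); first exact: (dP k).1.
  move=> z [_ yz] i; have := yz 0 i; rewrite /ball /= ltr_distl.
  by have := kP i; lra.
move=> D _ DP.
pose N := (\max_(k <- finmap.enum_fset D) k).+1.
have cov := cube_cover_le p r N (fun k => (c k).1) (fun k => (c k).2) d r0
  (fun k => (dP k).1) cle.
have {cov} rle : r ^+ n <= \sum_(k < N) \prod_i ((c k).2 0 i - (c k).1 0 i + d k *+ 3).
  apply: cov.
  move=> y yP; have [|k kD kP] := DP y; first by move=> i; rewrite /= in_itv /= yP.
  exists k; first by rewrite ltnS; exact: (leq_bigmax_seq (r := finmap.enum_fset D) (P := xpredT) (F := id) k).
  by move=> i; exact: (interior_subset kP).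
have := le_trans rle (ler_sum _ (fun (k : 'I_N) _ => (dP k).2)).
apply/negP; rewrite -ltNge -lte_fin.
rewrite -(big_mkord xpredT (fun k => v k + e / (2 ^ k.+1)%:R)) -sumEFin.
have pos k : (0 <= (v k)%:E + (e / (2 ^ k.+1)%:R)%:E)%E.
  by rewrite -EFinD lee_fin addr_ge0 // ltW.
apply: (@le_lt_trans _ _ (\sum_(0 <= k <oo) ((v k)%:E + (e / (2 ^ k.+1)%:R)%:E))%E).
  by apply: (@nneseries_lim_ge R (fun k => (v k)%:E + (e / (2 ^ k.+1)%:R)%:E)%E xpredT 0 N) => k _ _.
apply: (@le_lt_trans _ _ (\sum_(0 <= k <oo) (v k)%:E + e%:E)%E).
  by apply: epsilon_trick; [move=> k; rewrite lee_fin | exact: ltW].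
have -> : (r ^+ n)%:E = (e%:E + e%:E :> \bar R)%E.
  by rewrite -EFinD /e; congr (_%:E); field.
by rewrite lteD2rE.
Qed.

End CubeMeasure.

(** * Maximum principle for the Alexandrov equation *)

Section MaximumPrinciple.
Context {R : realType} {n : nat}.
Implicit Types (U A : set 'rV[R]_n) (x y p : 'rV[R]_n).

Lemma bounded_closure A : bounded_set A ->
  exists2 D : R, 0 < D & forall x, closure A x -> `|x| <= D.
Proof.
move=> [M [_ HM]]; exists (`|M| + 2); first by have := normr_ge0 M; lra.
move=> x clx; have [y [Ay xy]] := clx _ (nbhsx_ballx x 1 ltr01).
rewrite -ball_normE /= in xy.
have yM : `|y| <= `|M| + 1.
  by apply: HM => //; rewrite (le_lt_trans (ler_norm M)) // ltrDl.
have xy' : `|x - y| < 1 := xy.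
by have := norm_le_sub x y; lra.
Qed.

Lemma bounded_closure_diam A : bounded_set A ->
  exists2 D : R, 0 < D & forall x y, closure A x -> closure A y -> `|x - y| <= D.
Proof.
move=> /bounded_closure[D D0 bA]; exists (2 * D); first by lra.
by move=> x y /bA bx /bA by_; have := norm_sub_le x y; lra.
Qed.

Lemma bounded_closure_compact A : bounded_set A -> compact (closure A).
Proof.
move=> /bounded_closure[D D0 bA]; apply: bounded_closed_compact; last exact: closed_closure.
exists D; split; first exact: num_real.
by move=> M DM x /bA bx /=; exact: le_trans (ltW DM).
Qed.

Lemma bdry_openE U x : open U -> bdry U x <-> closure U x /\ ~ U x.
Proof. by move=> /interior_id oU; rewrite /bdry oU. Qed.

(* If l exceeds u at z, then all slopes close to that of l are slopes of
   supporting planes of u over U, so the image of the subdifferential contains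
   a cube. *)
Lemma affine_le_of_alexandrov U (u : 'rV[R]_n -> R) p (c : R) :
  open U -> bounded_set U -> {within closure U, continuous u} ->
  alexandrov_det_hessian_eq0 U u ->
  (forall y, bdry U y -> dot p y + c <= u y) ->
  forall z, U z -> dot p z + c <= u z.
Proof.
move=> oU bU cu ma lb z Uz; rewrite leNgt; apply/negP => ul.
have [D D0 diam] := bounded_closure_diam U bU.
have cpt := bounded_closure_compact U bU.
pose d := dot p z + c - u z.
have d0 : 0 < d by rewrite /d; lra.
have nD : 0 < n%:R * D + 1 by rewrite ltr_wpDl // mulr_ge0 // ltW.
(* A change of slope by at most [r] changes differences of values over [U] by at most [d / 2], so
   the minimum of [u - dot q] cannot be attained on the boundary. *)
pose r := d / 2 / (n%:R * D + 1).
have r0 : 0 < r by rewrite !divr_gt0.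
have bU' : borel U by exact: sub_sigma_algebra.
pose A := \bigcup_(x in U) subdifferential U u x.
have A0 : lebesgue_outer A = 0%E := ma U bU' (fun x Ux => Ux).
apply: (lebesgue_outer_cube_neq0 p r A r0 _ A0) => q qP.
have qp : `|p - q| <= r.
  apply: norm_row_le => [|i]; first exact: ltW.
  by rewrite !mxE ler_distl; have := qP i; lra.
have cq : {within closure U, continuous (fun y => u y - dot q y)}.
  move=> y; apply: cvgB; first exact: cu.
  apply: (@continuous_subspaceT _ _ (closure U) (dot q)) => y'.
  exact: continuous_dot.
have [|y /set_mem cly ymin] := compact_EVT_min _ cpt cq.
  by exists z; exact: subset_closure.
have {}ymin x : closure U x -> u y - dot q y <= u x - dot q x.
  by move=> clx; apply: ymin; rewrite inE.
have Uy : U y.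
  apply: contrapT => nUy.
  have := lb y ((bdry_openE U y oU).2 (conj cly nUy)).
  have := ymin z (subset_closure Uz).
  have := dot_ge (p - q) (y - z).
  have : n%:R * `|p - q| * `|y - z| <= d / 2.
    apply: (@le_trans _ _ (n%:R * r * D)).
      rewrite ler_pM ?mulr_ge0 // ?ler_wpM2l //.
      by apply: diam => //; exact: subset_closure.
    have : r * (n%:R * D + 1) = d / 2 by rewrite /r divfK // gt_eqF.
    lra.
  rewrite dotBl !dotBr /d; lra.
exists y => // x Ux; rewrite dotBr.
by have := ymin x (subset_closure Ux); lra.
Qed.

End MaximumPrinciple.

(** * Segments, and passage from a star-shaped set to its closure *)

Section Segments.
Context {R : realType} {n : nat}.
Implicit Types (A : set 'rV[R]_n) (f : 'rV[R]_n -> R) (x y z o p : 'rV[R]_n).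

Definition seg (s : R) x y : 'rV[R]_n := (1 - s) *: x + s *: y.

Lemma dot_seg p s x y : dot p (seg s x y) = (1 - s) * dot p x + s * dot p y.
Proof. by rewrite dotDr !dotZr. Qed.

Lemma seg0 x y : seg 0 x y = x.
Proof. by rewrite /seg subr0 scale1r scale0r addr0. Qed.

Lemma seg1 x y : seg 1 x y = y.
Proof. by rewrite /seg subrr scale0r scale1r add0r. Qed.

Lemma segxx s x : seg s x x = x.
Proof. by rewrite /seg -scalerDl subrK scale1r. Qed.

Lemma segC s x y : seg s x y = seg (1 - s) y x.
Proof. by rewrite /seg opprB addrC subrKC. Qed.

Lemma convex_setE A : convex_set A <->
  forall s x y, A x -> A y -> 0 <= s <= 1 -> A (seg s x y).
Proof.
split=> [cA s x y Ax Ay /andP[s0 s1]|cA x y t /set_mem Ax /set_mem Ay].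
  have s0' : 0 <= 1 - s by rewrite subr_ge0.
  have s1' : 1 - s <= 1 by rewrite gerBl.
  have := cA x y (Itv01 s0' s1'); rewrite !inE => /(_ Ax Ay).
  by rewrite /conv /= /unstable.onem opprB addrCA subrr addr0.
rewrite inE; have := cA (1 - t%:num) x y Ax Ay.
by rewrite /seg opprB addrCA subrr addr0 subr_ge0 gerBl ge0 le1; apply.
Qed.

Lemma convex_functionE A f : convex_function A f <->
  forall s x y, A x -> A y -> 0 <= s <= 1 ->
    f (seg s x y) <= (1 - s) * f x + s * f y.
Proof.
split=> [cA s x y Ax Ay /andP[s0 s1]|cA t x y /set_mem Ax /set_mem Ay].
  have s0' : 0 <= 1 - s by rewrite subr_ge0.
  have s1' : 1 - s <= 1 by rewrite gerBl.
  have := cA (Itv01 s0' s1') x y; rewrite !inE => /(_ Ax Ay).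
  by rewrite convRE /conv /= /unstable.onem opprB addrCA subrr addr0.
have := cA (1 - t%:num) x y Ax Ay.
rewrite /seg opprB addrCA subrr addr0 subr_ge0 gerBl ge0 le1 convRE.
by apply.
Qed.

Lemma seg_cvg x y : seg s x y @[s --> (0 : R)^'+] --> x.
Proof.
rewrite -[X in _ --> X](seg0 x y); apply: cvg_at_right_filter.
apply: cvgD.
  by apply: cvgZr_tmp; apply: cvgB; [exact: cvg_cst|exact: cvg_id].
by apply: cvgZr_tmp; exact: cvg_id.
Qed.

Lemma near_at_right01 (P : R -> Prop) : (forall s : R, 0 < s <= 1 -> P s) ->
  \forall s \near (0 : R)^'+, P s.
Proof.
move=> h; near=> s; apply: h; apply/andP; split; near: s.
  exact: nbhs_right_gt.
exact: nbhs_right_le.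
Unshelve. all: by end_near. Qed.

Lemma seg_cvg_within A f x y : {within A, continuous f} -> A x ->
  (forall s, 0 < s <= 1 -> A (seg s x y)) ->
  f (seg s x y) @[s --> (0 : R)^'+] --> f x.
Proof.
move=> /subspace_continuousP cf Ax Aseg.
apply: cvg_comp (cf x Ax) => P wP.
have := seg_cvg x y _ wP.
apply: filter_app; apply: near_at_right01 => s s01; apply; exact: Aseg.
Qed.

Lemma closure_seg A z o : (forall s : R, 0 < s <= 1 -> A (seg s z o)) -> closure A z.
Proof.
move=> Aseg B nB.
have AB := @filterI _ _ (at_right_proper_filter (0 : R)) _ _
  (near_at_right01 (fun s => A (seg s z o)) Aseg) (seg_cvg z o B nB).
by have [s [As Bs]] := @filter_ex _ _ (at_right_proper_filter 0) _ AB; exists (seg s z o).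
Qed.

(** Shrinking towards [o] commutes with convex combinations; this is how convexity inequalities on a
    set extend to its closure as [e] tends to 0. *)
Lemma seg_seg s e x y o : seg s (seg e x o) (seg e y o) = seg e (seg s x y) o.
Proof. by rewrite /seg; apply/rowP => i; rewrite !mxE; ring. Qed.

Section Star.
Context {A : set 'rV[R]_n} {o : 'rV[R]_n}.
Hypothesis star : forall x s, closure A x -> 0 < s <= 1 -> A (seg s x o).

Lemma star_closure_seg s x y : convex_set A -> closure A x -> closure A y ->
  0 <= s <= 1 -> closure A (seg s x y).
Proof.
move=> /convex_setE cA clx cly s01; apply: (closure_seg A _ o) => e e01.
by rewrite -seg_seg; apply: cA => //; exact: star.
Qed.

Lemma star_cvg f x : {within closure A, continuous f} -> closure A x ->
  f (seg s x o) @[s --> (0 : R)^'+] --> f x.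
Proof.
move=> cf clx; apply: (seg_cvg_within (closure A)) => // s s01.
exact/subset_closure/star.
Qed.

Lemma convex_function_closure f s x y : convex_set A -> convex_function A f ->
  {within closure A, continuous f} -> closure A x -> closure A y ->
  0 <= s <= 1 -> f (seg s x y) <= (1 - s) * f x + s * f y.
Proof.
move=> cA /convex_functionE cvf cf clx cly s01.
have lhs := star_cvg f (seg s x y) cf (star_closure_seg s x y cA clx cly s01).
have rhs : (1 - s) * f (seg e x o) + s * f (seg e y o) @[e --> (0 : R)^'+] -->
    (1 - s) * f x + s * f y.
  by apply: cvgD; apply: cvgMl_tmp; exact: star_cvg.
apply: (ler_cvg_to lhs rhs); apply: near_at_right01 => e e01.
by rewrite -seg_seg; apply: cvf => //; exact: star.
Qed.

Lemma affine_le_closure f p c x : {within closure A, continuous f} ->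
  (forall y, A y -> dot p y + c <= f y) -> closure A x -> dot p x + c <= f x.
Proof.
move=> cf lf clx.
have rhs := star_cvg f x cf clx.
have lhs : dot p (seg e x o) + c @[e --> (0 : R)^'+] --> dot p x + c.
  apply: cvgD; last exact: cvg_cst.
  by apply: (cvg_comp _ _ (seg_cvg x o)); exact: continuous_dot.
apply: (ler_cvg_to lhs rhs); apply: near_at_right01 => e e01.
exact/lf/star.
Qed.

End Star.

End Segments.

(** * Moduli, data, touching planes, and gradient bounds from small gaps *)

Section TouchingEstimates.
Context {R : realType} {n : nat}.
Implicit Types (U : set 'rV[R]_n) (x y p : 'rV[R]_n) (w : R -> R).

(** The properties of the function [r ^ alpha] that the estimates use; [modulus_scale] lets any
    fixed multiple of a distance be absorbed into the constants. *)
Record modulus w : Prop := Modulus {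
  modulus_ge0 : forall r, 0 <= r -> 0 <= w r;
  modulus_gt0 : forall r, 0 < r -> 0 < w r;
  modulus_mono : forall r s, 0 <= r -> r <= s -> w r <= w s;
  modulus_scale : forall K r, 1 <= K -> 0 <= r -> w (K * r) <= K * w r;
  modulus_small : forall e, 0 < e -> exists2 r, 0 < r & w r < e }.

(** The first-order Taylor error of a function whose gradient has modulus [w]; for the Hoelder
    modulus it is [r ^ (1 + alpha)]. *)
Definition Phi w r : R := r * w r.

(* A convex domain seen from o: every point is seg lam b o with b a boundary
   point, and lam is comparable to the distance to the boundary. *)
Record ray_domain U (o : 'rV[R]_n) (r0 D : R) : Prop := RayDomain {
  ray_r0 : 0 < r0 <= 1;
  ray_D : 1 <= D;
  ray_ball : forall v, `|v| < r0 -> U (o + v);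
  ray_star : forall x y s, closure U x -> U y -> 0 < s <= 1 -> U (seg s x y);
  ray_convex : forall x y s, closure U x -> closure U y -> 0 <= s <= 1 ->
    closure U (seg s x y);
  ray_diam : forall x y, closure U x -> closure U y -> `|x - y| <= D;
  ray_dec : forall x, closure U x -> exists b lam,
    [/\ closure U b, ~ U b, 0 <= lam <= 1 & x = seg lam b o] }.

Record regular_datum U (o : 'rV[R]_n) w (f : 'rV[R]_n -> R)
    (G : 'rV[R]_n -> 'rV[R]_n) (H M m : R) : Prop := RegularDatum {
  datum_const : [/\ 0 <= H, 0 <= M & 0 < m];
  datum_convex : forall s x y, closure U x -> closure U y -> 0 <= s <= 1 ->
    f (seg s x y) <= (1 - s) * f x + s * f y;
  datum_upper : forall x y, U x -> closure U y ->
    f y <= f x + dot (G x) (y - x) + H * Phi w `|y - x|;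
  datum_lower : forall x y, U x -> closure U y ->
    f x + dot (G x) (y - x) <= f y;
  datum_grad : forall x, U x -> `|G x| <= M;
  datum_bdry : forall x, closure U x -> ~ U x -> f x = 0;
  datum_center : f o <= - m }.

(* The graph of y, s |-> p . y + q s + c lies below those of f0 at s = 0 and
   f1 at s = 1, and touches them above x0 and x1. *)
Record touching U (f0 f1 : 'rV[R]_n -> R) x0 x1 p (q c : R) : Prop := Touching {
  touch_cl0 : closure U x0;
  touch_cl1 : closure U x1;
  touch_le0 : forall y, closure U y -> dot p y + c <= f0 y;
  touch_le1 : forall y, closure U y -> dot p y + q + c <= f1 y;
  touch_eq0 : f0 x0 = dot p x0 + c;
  touch_eq1 : f1 x1 = dot p x1 + q + c }.

(** Time reversal: in the variable [1 - s], the plane has time slope [- q] and constant [q + c]. *)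
Lemma touchingC U f0 f1 x0 x1 p q c : touching U f0 f1 x0 x1 p q c ->
  touching U f1 f0 x1 x0 p (- q) (q + c).
Proof.
case=> cl0 cl1 le0 le1 eq0 eq1; split=> //.
- by move=> y /le1; rewrite addrA.
- by move=> y /le0; lra.
- by rewrite eq1 addrA.
- by rewrite eq0; lra.
Qed.

(* Chords between the two graphs show that a function convex in (x, t), with the
   traces f0 and f1, exceeds the plane by at most B at (y, s). *)
Definition chord_below U (f0 f1 : 'rV[R]_n -> R) p (q c : R) y (s B : R) : Prop :=
  exists a b, [/\ closure U a, closure U b, y = seg s a b &
    (1 - s) * f0 a + s * f1 b <= dot p y + q * s + c + B].

Lemma chord_belowC U f0 f1 p q c y s B :
  chord_below U f1 f0 p (- q) (q + c) y (1 - s) B -> chord_below U f0 f1 p q c y s B.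
Proof.
move=> [b [a [clb cla yE hB]]]; exists a, b; split=> //; first by rewrite segC.
by move: hB; rewrite opprB addrCA subrr addr0; lra.
Qed.

Lemma chord_below_le U f0 f1 p q c y s B B' : B <= B' ->
  chord_below U f0 f1 p q c y s B -> chord_below U f0 f1 p q c y s B'.
Proof.
by move=> BB [a [b [cla clb yE hB]]]; exists a, b; split=> //; rewrite (le_trans hB) ?lerD2l.
Qed.

Section Modulus.
Context {w : R -> R}.
Hypothesis mw : modulus w.

Lemma Phi_ge0 r : 0 <= r -> 0 <= Phi w r.
Proof. by move=> r0; rewrite mulr_ge0 // (modulus_ge0 _ mw). Qed.

Lemma Phi_mono r s : 0 <= r -> r <= s -> Phi w r <= Phi w s.
Proof.
by move=> r0 rs; rewrite ler_pM // ?(modulus_ge0 _ mw) // (modulus_mono _ mw).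
Qed.

Lemma Phi_scale K r : 1 <= K -> 0 <= r -> Phi w (K * r) <= K * K * Phi w r.
Proof.
move=> K1 r0; have K0 : 0 <= K by lra.
have -> : K * K * Phi w r = (K * r) * (K * w r) by rewrite /Phi; ring.
by rewrite /Phi ler_wpM2l ?mulr_ge0 // (modulus_scale _ mw).
Qed.

Lemma Phi_le K r s : 1 <= K -> 0 <= r -> 0 <= s -> s <= K * r ->
  Phi w s <= K * K * Phi w r.
Proof. by move=> K1 r0 s0 sK; apply: le_trans (Phi_scale K r K1 r0); exact: Phi_mono. Qed.

Section Domain.
Context {U : set 'rV[R]_n} {o : 'rV[R]_n} {r0 D : R}.
Hypothesis dU : ray_domain U o r0 D.

(** The homothety with centre [b] and ratio [lam] maps the ball of radius [r0] about [o] to this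
    ball, and it maps [U] into itself. *)
Lemma ray_ball_at b lam v : closure U b -> 0 < lam <= 1 -> `|v| < lam * r0 ->
  U (seg lam b o + v).
Proof.
move=> clb lam01 vl; have l0 : 0 < lam by lra.
have -> : seg lam b o + v = seg lam b (o + lam^-1 *: v).
  rewrite /seg scalerDr addrA scalerA mulfV ?scale1r // gt_eqF //.
apply: (ray_star _ _ _ _ dU) => //; apply: (ray_ball _ _ _ _ dU).
by rewrite normrZ gtr0_norm ?invr_gt0 // ltr_pdivrMl.
Qed.

Lemma ray_dist b lam : closure U b -> 0 <= lam -> `|b - seg lam b o| <= lam * D.
Proof.
move=> clb l0; have -> : b - seg lam b o = lam *: (b - o).
  by rewrite /seg; apply/rowP => i; rewrite !mxE; ring.
rewrite normrZ ger0_norm // ler_wpM2l // (ray_diam _ _ _ _ dU) //.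
apply: subset_closure; rewrite -(addr0 o); apply: (ray_ball _ _ _ _ dU).
by rewrite normr0; have := ray_r0 _ _ _ _ dU; lra.
Qed.

Lemma ray_inside b lam : closure U b -> ~ U b -> 0 <= lam <= 1 ->
  U (seg lam b o) <-> 0 < lam.
Proof.
move=> clb nUb l01; split=> [Us|l0].
  rewrite lt_neqAle (andP l01).1 andbT; apply/eqP => l0.
  by apply: nUb; move: Us; rewrite -l0 seg0.
rewrite -[seg _ _ _]addr0; apply: ray_ball_at => //.
  by rewrite l0; case/andP: l01.
by rewrite normr0 mulr_gt0 //; have := ray_r0 _ _ _ _ dU; lra.
Qed.

Section Datum.
Context {f : 'rV[R]_n -> R} {G : 'rV[R]_n -> 'rV[R]_n} {H M m : R}.
Hypothesis rf : regular_datum U o w f G H M m.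

(* W = f - (p . y + c) is nonnegative and at most e at x, so its gradient at x
   is controlled by e and by the room rho around x. *)
Lemma grad_gap_le x p (c e rho : R) :
  (forall y, closure U y -> dot p y + c <= f y) ->
  0 < rho -> (forall v, `|v| <= rho -> U (x + v)) ->
  f x - (dot p x + c) <= e -> `|G x - p| * rho <= e + H * Phi w rho.
Proof.
move=> lf rho0 room fx.
have [H0 _ _] := datum_const _ _ _ _ _ _ _ _ rf.
have Ux : U x by rewrite -(addr0 x); apply: room; rewrite normr0 ltW.
have key v : `|v| <= rho -> dot (p - G x) v <= e + H * Phi w rho.
  move=> vr; have cl := subset_closure (room v vr).
  have := datum_upper _ _ _ _ _ _ _ _ rf x (x + v) Ux cl.
  have := lf _ cl.
  have -> : x + v - x = v by rewrite addrAC subrr add0r.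
  have : H * Phi w `|v| <= H * Phi w rho by rewrite ler_wpM2l // Phi_mono.
  rewrite dotBl dotDr; lra.
rewrite -ler_pdivlMr //; apply: norm_row_le => [|i].
  apply: divr_ge0; last exact: ltW.
  apply: addr_ge0; last by rewrite mulr_ge0 // Phi_ge0 // ltW.
  by have := lf x (subset_closure Ux); lra.
rewrite ler_pdivlMr //.
have nr (k : R) : `|k| = rho -> `|k *: delta_mx 0 i : 'rV[R]_n| <= rho.
  by move=> kr; rewrite normrZ kr; apply: ler_piMr; [exact: ltW|exact: norm_delta_le].
have := key _ (nr rho _); have := key _ (nr (- rho) _).
rewrite !dotZr dot_delta normrN gtr0_norm // => /(_ erefl) h1 /(_ erefl) h2.
rewrite -[X in _ * X](gtr0_norm rho0) -normrM ler_norml.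
by move: h1 h2; rewrite !mxE; lra.
Qed.

(** With zero gap, [grad_gap_le] bounds [|G x - p|] by [H * w rho] for every small [rho], and this
    tends to 0. *)
Lemma grad_touch x p (c : R) :
  (forall y, closure U y -> dot p y + c <= f y) ->
  open U -> U x -> f x = dot p x + c -> G x = p.
Proof.
move=> lf oU Ux fx; apply/eqP; rewrite -subr_eq0 -normr_le0.
have [H0 _ _] := datum_const _ _ _ _ _ _ _ _ rf.
have [d /= d0 dU'] : exists2 d : R, 0 < d & forall v, `|v| <= d -> U (x + v).
  have /nbhs_ballP[d /= d0 dB] := open_nbhs_nbhs (conj oU Ux).
  exists (d / 2) => [|v vd]; first by rewrite divr_gt0.
  apply: dB; rewrite -ball_normE /= opprD addrA subrr add0r normrN.
  by rewrite (le_lt_trans vd) // ltr_pdivrMr //; lra.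
rewrite leNgt; apply/negP => g0.
have [r1 r10 wr1] := modulus_small _ mw (`|G x - p| / (H + 1)) (divr_gt0 g0 (ltr_wpDl H0 ltr01)).
pose rho := Num.min r1 d.
have rho0 : 0 < rho by rewrite lt_min r10.
have := grad_gap_le x p c 0 rho lf rho0.
rewrite fx subrr lexx add0r => /(_ _ isT)/Wrap[v vr|].
  by apply: dU'; rewrite (le_trans vr) // ge_min lexx orbT.
rewrite /Phi mulrCA mulrC ler_pM2l // leNgt => /negP; apply.
have wle : w rho <= w r1 by apply: (modulus_mono _ mw); [exact: ltW | rewrite ge_min lexx].
have := modulus_gt0 _ mw _ rho0.
move: wr1; rewrite ltr_pdivlMr; nra.
Qed.

End Datum.

End Domain.
End Modulus.
End TouchingEstimates.

(** * Chord estimates, with the endpoint at time 1 as the deeper one *)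

Section ConvexCombinationEstimates.
Context {R : realType} {n : nat} {U : set 'rV[R]_n} {o : 'rV[R]_n} {r0 D : R}
  {w : R -> R} {f0 f1 : 'rV[R]_n -> R} {G0 G1 : 'rV[R]_n -> 'rV[R]_n} {H M m : R}.
Hypothesis oU : open U.
Hypothesis mw : modulus w.
Hypothesis dU : ray_domain U o r0 D.
Hypothesis rf0 : regular_datum U o w f0 G0 H M m.
Hypothesis rf1 : regular_datum U o w f1 G1 H M m.
Implicit Types (x y p b : 'rV[R]_n).

Lemma near_estimate (sg : R) x0 x1 p (q c : R) b1 (lam1 t s : R) y (h : R) :
  touching U f0 f1 x0 x1 p q c ->
  closure U b1 -> 0 < lam1 <= 1 -> x1 = seg lam1 b1 o ->
  0 < sg -> sg <= s <= 1 -> `|y - seg t x0 x1| <= h -> `|s - t| <= h ->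
  (1 + D) / sg * h < lam1 * r0 ->
  chord_below U f0 f1 p q c y s (H * Phi w ((1 + D) / sg * h)).
Proof.
move=> tch clb1 lam01 x1E sg0 s01 yh sth hK.
have [cl0 cl1 le0 le1 eq0 eq1] := tch.
have [H0 _ _] := datum_const _ _ _ _ _ _ _ _ rf1.
have s0 : 0 < s by lra.
(* The solution of [y = seg s x0 (x1 + v)]. Dividing by [s] is why times are kept above [sg]; the
   factor [1 + D] accounts for the shift in space and the shift in time. *)
pose v := s^-1 *: (y - seg t x0 x1 + (s - t) *: (x0 - x1)).
have yE : y = seg s x0 (x1 + v).
  rewrite /seg /v scalerDr scalerA mulfV ?gt_eqF // scale1r /seg.
  by apply/rowP => i; rewrite !mxE; ring.
have h0 : 0 <= h by apply: le_trans sth.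
have vh : `|v| <= (1 + D) / sg * h.
  rewrite normrZ gtr0_norm ?invr_gt0 //.
  have n1 : `|y - seg t x0 x1 + (s - t) *: (x0 - x1)| <= (1 + D) * h.
    apply: le_trans (ler_normD _ _) _; rewrite normrZ mulrDl mul1r lerD //.
    by rewrite mulrC ler_pM // (ray_diam _ _ _ _ dU).
  have -> : (1 + D) / sg * h = sg^-1 * ((1 + D) * h) by ring.
  apply: ler_pM => //; first by rewrite invr_ge0 ltW.
  by rewrite lef_pV2 ?posrE //; lra.
have Ub : U (x1 + v).
  by rewrite x1E; apply: (ray_ball_at dU) => //; exact: le_lt_trans vh hK.
have Ux1 : U x1.
  rewrite -(addr0 x1) x1E; apply: (ray_ball_at dU) => //.
  by rewrite normr0 mulr_gt0 //; have := ray_r0 _ _ _ _ dU; lra.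
exists x0, (x1 + v); split=> //; first exact: subset_closure.
have Gp : G1 x1 = p.
  apply: (grad_touch mw rf1 x1 p (q + c)) => //.
    by move=> z /le1; rewrite addrA.
  by rewrite eq1 addrA.
have := datum_upper _ _ _ _ _ _ _ _ rf1 x1 (x1 + v) Ux1 (subset_closure Ub).
have -> : x1 + v - x1 = v by rewrite addrAC subrr add0r.
rewrite Gp eq1 => ub.
have ub' : f1 (x1 + v) <= dot p (x1 + v) + q + c + H * Phi w ((1 + D) / sg * h).
  apply: (le_trans ub); rewrite dotDr.
  have : H * Phi w `|v| <= H * Phi w ((1 + D) / sg * h).
    by rewrite ler_wpM2l // Phi_mono.
  lra.
have -> : dot p y = (1 - s) * dot p x0 + s * dot p (x1 + v) by rewrite {1}yE dot_seg.
have : s * f1 (x1 + v) <=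
  s * (dot p (x1 + v) + q + c + H * Phi w ((1 + D) / sg * h)).
  by rewrite ler_wpM2l // ltW.
have : s * (H * Phi w ((1 + D) / sg * h)) <= H * Phi w ((1 + D) / sg * h).
  rewrite ler_piMl ?(andP s01).2 // mulr_ge0 // Phi_ge0 //.
  by apply: le_trans vh.
rewrite eq0; lra.
Qed.

Section Configuration.
Context {x0 x1 p b0 b1 : 'rV[R]_n} {q c lam0 lam1 : R}.
Hypothesis tch : touching U f0 f1 x0 x1 p q c.
Hypothesis clb0 : closure U b0.
Hypothesis nUb0 : ~ U b0.
Hypothesis lam001 : 0 <= lam0 <= 1.
Hypothesis x0E : x0 = seg lam0 b0 o.
Hypothesis clb1 : closure U b1.
Hypothesis nUb1 : ~ U b1.
Hypothesis lam101 : 0 < lam1 <= 1.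
Hypothesis x1E : x1 = seg lam1 b1 o.
Hypothesis lam01 : lam0 <= lam1.

(** A bound for the Taylor error over any step of length at most [D * lam1], in particular from [x0]
    to [b0] and from [x1] to [b1]; the square of [D] comes from [Phi_scale]. *)
Let E := H * D ^+ 2 * Phi w lam1.
Let xs t := seg t b0 x1.
Let W1 x := f1 x - (dot p x + (q + c)).

Let H0 : 0 <= H. Proof. by case: (datum_const _ _ _ _ _ _ _ _ rf1). Qed.
Let M0 : 0 <= M. Proof. by case: (datum_const _ _ _ _ _ _ _ _ rf1). Qed.
Let m0 : 0 < m. Proof. by case: (datum_const _ _ _ _ _ _ _ _ rf1). Qed.
Let D1 : 1 <= D. Proof. exact: ray_D dU. Qed.
Let r00 : 0 < r0. Proof. by case/andP: (ray_r0 _ _ _ _ dU). Qed.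
Let r01 : r0 <= 1. Proof. by case/andP: (ray_r0 _ _ _ _ dU). Qed.
Let D0 : 0 <= D. Proof. exact: le_trans ler01 D1. Qed.
Let lam10 : 0 < lam1. Proof. by case/andP: lam101. Qed.
Let lam00 : 0 <= lam0. Proof. by case/andP: lam001. Qed.
Let HD0 : 0 <= H * D ^+ 2. Proof. by rewrite mulr_ge0 ?sqr_ge0. Qed.
Let E0 : 0 <= E.
Proof. by apply: mulr_ge0 => //; apply: Phi_ge0 => //; exact: ltW. Qed.

Let Ux1 : U x1.
Proof.
by rewrite x1E; apply/(ray_inside dU) => //; case/andP: lam101 => /ltW -> ->.
Qed.

Lemma config_slope : G1 x1 = p.
Proof.
have [_ _ _ le1 _ eq1] := tch.
apply: (grad_touch mw rf1 x1 p (q + c)) => //; last by rewrite eq1 addrA.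
by move=> z /le1; rewrite addrA.
Qed.

Let pM : `|p| <= M.
Proof. by rewrite -config_slope; exact: (datum_grad _ _ _ _ _ _ _ _ rf1). Qed.

Let bx0 : `|b0 - x0| <= lam0 * D.
Proof. by rewrite x0E; apply: (ray_dist dU). Qed.

Let bx1 : `|b1 - x1| <= lam1 * D.
Proof. by rewrite x1E; apply: (ray_dist dU) => //; exact: ltW. Qed.

Let bx01 : `|b0 - x0| <= lam1 * D.
Proof. by apply: le_trans bx0 _; rewrite ler_wpM2r. Qed.

Let PhiE d : 0 <= d -> d <= D * lam1 -> H * Phi w d <= E.
Proof.
move=> d0 dl; rewrite /E -mulrA ler_wpM2l // expr2.
by apply: Phi_le => //; exact: ltW.
Qed.

Lemma config_plane0 : - E <= dot p b0 + c.
Proof.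
have [_ _ le0 _ eq0 _] := tch.
have z0 : f0 b0 = 0 := datum_bdry _ _ _ _ _ _ _ _ rf0 b0 clb0 nUb0.
(* If [x0] is itself a boundary point it has no gradient to compare with [p], but then the plane
   touches the value 0 at [b0]. *)
have [l00|l00] := eqVneq lam0 0.
  have xb : x0 = b0 by rewrite x0E l00 seg0.
  by rewrite -xb -eq0 xb z0 oppr_le0.
have Ux0 : U x0.
  by rewrite x0E; apply/(ray_inside dU) => //; rewrite lt_neqAle eq_sym l00.
have Gp0 : G0 x0 = p by apply: (grad_touch mw rf0 x0 p c).
have := datum_upper _ _ _ _ _ _ _ _ rf0 x0 b0 Ux0 clb0.
have : H * Phi w `|b0 - x0| <= E by apply: PhiE => //; rewrite mulrC.
by rewrite Gp0 z0 eq0 dotBr; lra.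
Qed.

Lemma config_plane1 : - E <= dot p b1 + q + c.
Proof.
have [_ _ _ _ _ eq1] := tch.
have z1 : f1 b1 = 0 := datum_bdry _ _ _ _ _ _ _ _ rf1 b1 clb1 nUb1.
have := datum_upper _ _ _ _ _ _ _ _ rf1 x1 b1 Ux1 clb1.
have : H * Phi w `|b1 - x1| <= E by apply: PhiE => //; rewrite mulrC.
by rewrite config_slope z1 eq1 dotBr; lra.
Qed.

(** Over [b0] the plane is at least [- E] at time 0 and at most [f1 b0 = 0] at time 1, so [q <= E];
    over [b1] the two times exchange roles. *)
Lemma config_speed : `|q| <= E.
Proof.
have [_ _ le0 le1 _ _] := tch.
have z01 : f1 b0 = 0 := datum_bdry _ _ _ _ _ _ _ _ rf1 b0 clb0 nUb0.
have z10 : f0 b1 = 0 := datum_bdry _ _ _ _ _ _ _ _ rf0 b1 clb1 nUb1.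
have := config_plane0; have := config_plane1.
have := le1 _ clb0; have := le0 _ clb1; rewrite z01 z10 ler_norml.
by lra.
Qed.

Section Gap.
Context {tau t : R}.
Hypothesis tau0 : 0 < tau.
Hypothesis taut : tau <= t.
Hypothesis t1 : t <= 1.

Let t0 : 0 < t. Proof. exact: lt_le_trans taut. Qed.
(** Half of a radius available around [xs t]: shifting [xs t] by [v] amounts to shifting [x1] by
    [v / t], and the ball of radius [lam1 * r0] about [x1] lies in [U]. *)
Let rho := tau * lam1 * r0 / 2.
Let rho0 : 0 < rho. Proof. by rewrite /rho divr_gt0 // !mulr_gt0. Qed.

Let rhoD : rho <= D * lam1.
Proof.
have : tau * (lam1 * r0) <= 1 * (lam1 * r0).
  by apply: ler_wpM2r; [rewrite mulr_ge0 ?ltW | exact: le_trans t1].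
have : lam1 * r0 <= lam1 * 1 by apply: ler_wpM2l => //; exact: ltW.
have : 1 * lam1 <= D * lam1 by apply: ler_wpM2r => //; exact: ltW.
by move: (lam10); rewrite /rho; lra.
Qed.

Let room v : `|v| <= rho -> U (xs t + v).
Proof.
move=> vr.
have -> : xs t + v = seg t b0 (x1 + t^-1 *: v).
  by rewrite /xs /seg scalerDr addrA scalerA mulfV ?scale1r // gt_eqF.
apply: (ray_star _ _ _ _ dU) => //; last by rewrite t0.
rewrite x1E; apply: (ray_ball_at dU) => //.
rewrite normrZ gtr0_norm ?invr_gt0 // ltr_pdivrMl //; apply: le_lt_trans vr _.
have : tau * (lam1 * r0) <= t * (lam1 * r0).
  by apply: ler_wpM2r => //; rewrite mulr_ge0 ?ltW.
have : 0 < tau * (lam1 * r0) by rewrite !mulr_gt0.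
by rewrite /rho; lra.
Qed.

(** At [b0] the gap is [- (dot p b0 + c) - q], one [E] for each term; at [x1] it vanishes; convexity
    interpolates. *)
Let W1xs : W1 (xs t) <= 2 * E.
Proof.
have [_ cl1 _ _ _ eq1] := tch.
have z01 : f1 b0 = 0 := datum_bdry _ _ _ _ _ _ _ _ rf1 b0 clb0 nUb0.
have W1b0 : W1 b0 <= 2 * E.
  have := config_speed; have := config_plane0.
  by rewrite /W1 z01 ler_norml; lra.
have t01 : 0 <= t <= 1 by rewrite ltW.
have s0 : 0 <= 1 - t by rewrite subr_ge0.
have := datum_convex _ _ _ _ _ _ _ _ rf1 t b0 x1 clb0 cl1 t01.
have := ler_wpM2l s0 W1b0; have := mulr_ge0 (ltW t0) E0.
by rewrite /W1 /xs dot_seg eq1; lra.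
Qed.

(** The gap [2 E] and the Taylor error [E] are divided by the room [rho], proportional to [lam1];
    this turns [Phi w lam1] into [w lam1]. *)
Lemma config_grad : `|G1 (xs t) - p| <= 6 * (H * D ^+ 2) / (tau * r0) * w lam1.
Proof.
have [_ _ _ le1 _ _] := tch.
have W1le z : closure U z -> dot p z + (q + c) <= f1 z by move=> /le1; rewrite addrA.
have gE := grad_gap_le mw rf1 (xs t) p (q + c) (2 * E) rho W1le rho0 room W1xs.
have HE := PhiE rho (ltW rho0) rhoD.
rewrite -(ler_pM2r rho0); apply: le_trans gE _.
have -> : 6 * (H * D ^+ 2) / (tau * r0) * w lam1 * rho = 3 * E.
  by rewrite /rho /E /Phi; field; rewrite !gt_eqF.
by move: HE; lra.
Qed.

(* The constant collects 2 E, the gradient term and the Hoelder term. *)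
Lemma config_gap z S : closure U z -> lam1 <= S -> `|z - xs t| <= S ->
  W1 z <= (2 * (H * D ^+ 2) + n%:R * (6 * (H * D ^+ 2) / (tau * r0)) + H) * Phi w S.
Proof.
move=> clz lS zS; have S0 : 0 <= S by apply: le_trans lS; exact: ltW.
have C20 : 0 <= 6 * (H * D ^+ 2) / (tau * r0).
  by rewrite divr_ge0 ?mulr_ge0 // ltW // mulr_gt0.
move: C20 config_grad; move: (6 * (H * D ^+ 2) / (tau * r0)) => C2 C20 gC2.
have Uxs : U (xs t) by rewrite -(addr0 (xs t)); apply: room; rewrite normr0 ltW.
have := datum_upper _ _ _ _ _ _ _ _ rf1 (xs t) z Uxs clz.
have PhiH : H * Phi w `|z - xs t| <= H * Phi w S.
  by apply: ler_wpM2l => //; exact: Phi_mono.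
have PhiEk : E <= H * D ^+ 2 * Phi w S.
  by apply: ler_wpM2l => //; apply: Phi_mono => //; exact: ltW.
have dg : dot (G1 (xs t) - p) (z - xs t) <= n%:R * C2 * Phi w S.
  apply: le_trans (dot_le _ _) _; rewrite -!(mulrA n%:R); apply: ler_wpM2l => //.
  apply: le_trans (ler_pM _ _ gC2 zS) _ => //.
  rewrite -mulrA; apply: ler_wpM2l => //.
  rewrite /Phi mulrC; apply: ler_wpM2l => //.
  by apply: (modulus_mono _ mw) => //; exact: ltW.
by have := W1xs; move: dg PhiH PhiEk; rewrite /W1 dotBl !dotBr; lra.
Qed.

End Gap.

(* The plane is at most - m mu at (y, s), but at least - C (lam1 + h) there. *)
Lemma config_depth t s y y0 mu h : 0 <= t <= 1 -> 0 <= s <= 1 ->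
  closure U y0 -> ~ U y0 -> 0 <= mu <= 1 -> y = seg mu y0 o -> closure U y ->
  closure U o -> `|y - seg t x0 x1| <= h -> `|s - t| <= 1 ->
  m * mu <= (n%:R * M * D + 2 * (H * D ^+ 2 * w 1)) * lam1 + n%:R * M * h.
Proof.
move=> /andP[t0 t1] /andP[s0 s1] cly0 nUy0 mu01 yE cly clo yh sth.
have [_ _ le0 le1 eq0 eq1] := tch.
have NM0 : 0 <= n%:R * M by exact: mulr_ge0.
have s10 : 0 <= 1 - s by rewrite subr_ge0.
have t10 : 0 <= 1 - t by rewrite subr_ge0.
have EE : E <= H * D ^+ 2 * w 1 * lam1.
  rewrite /E /Phi [lam1 * _]mulrC mulrA; apply: ler_wpM2r; first exact: ltW.
  apply: ler_wpM2l => //; apply: (modulus_mono _ mw); first exact: ltW.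
  by case/andP: lam101.
have dotM (v : 'rV[R]_n) k : `|v| <= k -> `|dot p v| <= n%:R * M * k.
  move=> vk; apply: le_trans (norm_dot_le _ _) _.
  by apply: ler_pM => //; rewrite ?mulr_ge0 ?ler_wpM2l.
have fmu f G : regular_datum U o w f G H M m -> f y <= - (m * mu).
  move=> rf; have := datum_convex _ _ _ _ _ _ _ _ rf mu y0 o cly0 clo mu01.
  rewrite -yE (datum_bdry _ _ _ _ _ _ _ _ rf _ cly0 nUy0).
  have : mu * f o <= mu * - m.
    by apply: ler_wpM2l; [case/andP: mu01 | exact: (datum_center _ _ _ _ _ _ _ _ rf)].
  by rewrite mulr0; lra.
have lup : dot p y + q * s + c <= - (m * mu).
  have := ler_wpM2l s10 (le_trans (le0 _ cly) (fmu _ _ rf0)).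
  have := ler_wpM2l s0 (le_trans (le1 _ cly) (fmu _ _ rf1)).
  by lra.
have qs : - E <= q * (s - t).
  suff : `|q * (s - t)| <= E by rewrite ler_norml => /andP[].
  by rewrite normrM -(mulr1 E); apply: ler_pM => //; exact: config_speed.
have ylow : - (n%:R * M * h) <= dot p (y - seg t x0 x1).
  by have := dotM _ _ yh; rewrite ler_norml => /andP[].
have lx0 : - (n%:R * M * (lam1 * D) + E) <= dot p x0 + c.
  have := dotM _ _ bx01; have := config_plane0.
  by rewrite dotBr ler_norml; lra.
have lx1 : - (n%:R * M * (lam1 * D) + E) <= dot p x1 + q + c.
  have := dotM _ _ bx1; have := config_plane1.
  by rewrite dotBr ler_norml; lra.
have := ler_wpM2l t10 lx0; have := ler_wpM2l t0 lx1.
move: ylow lup qs EE; rewrite dotBr dot_seg; lra.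
Qed.

End Configuration.

(** When [h] dominates [lam1], the point [y] is itself within O(h) of the boundary. Both ends [y0]
    and [y1] of the chord then stay within O(h) of [seg t b0 x1], so [config_gap] at scale [C8 * h]
    serves twice: it bounds [f1] above at [y1], and the plane below at [y0], where the data
    vanish. *)
Lemma far_estimate (tau kap : R) : 0 < tau <= 1 -> 0 < kap <= 1 ->
  exists C e : R, [/\ 0 <= C, 0 < e &
  forall x0 x1 p (q c : R) b0 (lam0 : R) b1 (lam1 t s : R) y (h : R),
  touching U f0 f1 x0 x1 p q c ->
  closure U b0 -> ~ U b0 -> 0 <= lam0 <= 1 -> x0 = seg lam0 b0 o ->
  closure U b1 -> ~ U b1 -> 0 < lam1 <= 1 -> x1 = seg lam1 b1 o ->
  lam0 <= lam1 -> tau <= t <= 1 - tau -> 0 < s < 1 -> U y ->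
  `|y - seg t x0 x1| <= h -> `|s - t| <= h ->
  kap * lam1 <= h -> h <= e ->
  chord_below U f0 f1 p q c y s (C * Phi w h)].
Proof.
move=> /andP[tau0 tau1] /andP[kap0 kap1].
have [H0 M0 m0] := datum_const _ _ _ _ _ _ _ _ rf1.
have /andP[r00 r01] := ray_r0 _ _ _ _ dU.
have D1 := ray_D _ _ _ _ dU.
have D0 : 0 <= D := le_trans ler01 D1.
have HD0 : 0 <= H * D ^+ 2 by rewrite mulr_ge0 ?sqr_ge0.
have NM0 : 0 <= n%:R * M by exact: mulr_ge0.
have w1 := modulus_ge0 _ mw 1 ler01.
have k1 : 1 <= kap^-1 by rewrite invf_ge1.
have k0 : 0 <= kap^-1 := le_trans ler01 k1.
(* [C3] is the constant of [config_gap]; [C5] and [C6] turn [config_depth] into [mu <= C6 * h]; [C7]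
   and [C8] bound the distances of [y0] and [y1] from [seg t b0 x1] in units of [h]. *)
have [C3 C30 C3E] : exists2 C3 : R, 0 <= C3 &
    C3 = 2 * (H * D ^+ 2) + n%:R * (6 * (H * D ^+ 2) / (tau * r0)) + H.
  eexists; last by [].
  have : 0 <= 6 * (H * D ^+ 2) / (tau * r0).
    by rewrite divr_ge0 ?mulr_ge0 // ltW // mulr_gt0.
  by move=> h; rewrite !addr_ge0 // mulr_ge0.
have [C5 C50 C5E] : exists2 C5 : R, 0 <= C5 &
    C5 = n%:R * M * D + 2 * (H * D ^+ 2 * w 1).
  by eexists; last by []; rewrite addr_ge0 ?mulr_ge0.
have [C6 C60 C6E] : exists2 C6 : R, 0 <= C6 & m * C6 = C5 / kap + n%:R * M.
  exists ((C5 / kap + n%:R * M) / m); last by rewrite mulrC divfK // gt_eqF.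
  by rewrite divr_ge0 ?addr_ge0 ?mulr_ge0 // ltW.
have C6D : 0 <= C6 * D by rewrite mulr_ge0.
have [C7 C71 [C7E C7k]] : exists2 C7 : R, 1 <= C7 &
    C7 = C6 * D + 1 + kap^-1 * D /\ kap^-1 <= C7.
  exists (C6 * D + 1 + kap^-1 * D).
    by rewrite addrAC lerDr addr_ge0 // mulr_ge0.
  split=> //; have : kap^-1 * 1 <= kap^-1 * D by exact: ler_wpM2l.
  by move: C6D; clear - oU mw dU rf0 rf1; lra.
have [C8 C87 C8E] : exists2 C8 : R, C7 <= C8 & C8 = C7 + C6 / (tau / 2) * D.
  by eexists; last by []; rewrite lerDl mulr_ge0 // divr_ge0 // ltW // divr_gt0.
have C81 : 1 <= C8 := le_trans C71 C87.
have C80 : 0 <= C8 := le_trans ler01 C81.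
have C388 : 0 <= C3 * (C8 * C8) by rewrite !mulr_ge0.
have HDk : 0 <= H * D ^+ 2 * (kap^-1 * kap^-1) by rewrite !mulr_ge0.
have C61 : 0 < C6 + 1 by rewrite ltr_wpDl.
(* The first bound keeps [s] above [tau / 2], the second makes [mu <= s], so that [y1] below is a
   convex combination. *)
pose e := Num.min (tau / 2) (tau / 2 / (C6 + 1)).
exists (C3 * (C8 * C8) * 2 + H * D ^+ 2 * (kap^-1 * kap^-1)), e; split.
- by rewrite addr_ge0 // mulr_ge0.
- by rewrite lt_min !divr_gt0.
move=> x0 x1 p q c b0 lam0 b1 lam1 t s y h tch clb0 nUb0 lam001 x0E clb1 nUb1
  lam101 x1E lam01 /andP[t0 t1] /andP[s0 s1] Uy yh sth kh.
rewrite le_min => /andP[he1 he2].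
have cly := subset_closure Uy.
have /andP[lam10 _] := lam101.
have h0 : 0 <= h by apply: le_trans sth.
have {}he2 : h * (C6 + 1) <= tau / 2 by rewrite -ler_pdivlMr.
have sta : tau / 2 <= s by move: sth t0 he1; rewrite ler_norml; clear - oU mw dU rf0 rf1; lra.
have t00 : 0 < t by exact: lt_le_trans t0.
have t11 : t <= 1 by move: t1 tau0; clear - oU mw dU rf0 rf1; lra.
have lamh : lam1 <= kap^-1 * h by rewrite -(ler_pM2l kap0) mulrA mulfV ?mul1r // gt_eqF.
have gap z := config_gap tch clb0 nUb0 lam001 x0E clb1 nUb1 lam101 x1E lam01 tau0 t0 t11 z (C8 * h).
have qE := config_speed tch clb0 nUb0 lam001 x0E clb1 nUb1 lam101 x1E lam01.
have [_ _ le0 le1 _ _] := tch.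
have [y0 [mu [cly0 nUy0 mu01 yE]]] := ray_dec _ _ _ _ dU y cly.
have /andP[mu0 mu1] := mu01.
have clo : closure U o.
  apply: subset_closure; rewrite -(addr0 o); apply: (ray_ball _ _ _ _ dU).
  by rewrite normr0.
have muh : mu <= C6 * h.
  rewrite -(ler_pM2l m0).
  have t01' : 0 <= t <= 1 by rewrite ltW.
  have s01' : 0 <= s <= 1 by rewrite !ltW.
  have st1 : `|s - t| <= 1 by apply: le_trans sth _; move: he1 tau1; clear - oU mw dU rf0 rf1; lra.
  have := config_depth tch clb0 nUb0 lam001 x0E clb1 nUb1 lam101 x1E lam01 t s y y0 mu h
    t01' s01' cly0 nUy0 mu01 yE cly clo yh st1.
  rewrite -C5E mulrA C6E.
  by have := ler_wpM2l C50 lamh; clear - oU mw dU rf0 rf1; lra.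
have mus : mu <= s by move: muh he2 h0 sta; clear - oU mw dU rf0 rf1; lra.
(* Since [s * (mu / s) = mu], the chord from [y0] at time 0 to [y1] at time 1 passes through [y] at
   time [s]. *)
pose y1 := seg (mu / s) y0 o.
have ms0 : 0 <= mu / s by rewrite divr_ge0 // ltW.
have cly1 : closure U y1.
  by apply: (ray_convex _ _ _ _ dU) => //; rewrite ms0 ler_pdivrMr // mul1r.
have yE1 : y = seg s y0 y1.
  by rewrite yE /y1 /seg; apply/rowP => i; rewrite !mxE; field; rewrite gt_eqF.
exists y0, y1; split=> //.
have y0xs : `|y0 - seg t b0 x1| <= C7 * h.
  have xxs : `|seg t x0 x1 - seg t b0 x1| <= kap^-1 * D * h.
    have -> : seg t x0 x1 - seg t b0 x1 = (1 - t) *: (x0 - b0).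
      by rewrite /seg; apply/rowP => i; rewrite !mxE; ring.
    rewrite normrZ ger0_norm ?subr_ge0 // distrC.
    apply: (@le_trans _ _ (1 * (lam0 * D))).
      apply: ler_pM; rewrite ?subr_ge0 ?gerBl ?(ltW t00) //.
      by rewrite x0E; apply: (ray_dist dU) => //; case/andP: lam001.
    rewrite mul1r mulrAC; apply: ler_wpM2r => //.
    exact: le_trans lamh.
  have y0y : `|y0 - y| <= C6 * h * D.
    apply: (@le_trans _ _ (mu * D)); last exact: ler_wpM2r.
    by rewrite yE; apply: (ray_dist dU).
  have := norm_sub_trans y0 y (seg t b0 x1).
  have := norm_sub_trans y (seg t x0 x1) (seg t b0 x1).
  by rewrite C7E; move: xxs y0y yh; clear - oU mw dU rf0 rf1; lra.
have C7h : C7 * h <= C8 * h by exact: ler_wpM2r.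
have y1xs : `|y1 - seg t b0 x1| <= C8 * h.
  have y1y0 : `|y1 - y0| <= C6 / (tau / 2) * D * h.
    apply: (@le_trans _ _ (mu / s * D)).
      by rewrite distrC; apply: (ray_dist dU).
    rewrite [leRHS]mulrAC; apply: ler_wpM2r => //.
    rewrite [leRHS]mulrAC; apply: ler_pM => //; first by rewrite invr_ge0 ltW.
    by rewrite lef_pV2 ?posrE // divr_gt0.
  have := norm_sub_trans y1 y0 (seg t b0 x1).
  by rewrite C8E; move: y1y0 y0xs; clear - oU mw dU rf0 rf1; lra.
have lamC8 : lam1 <= C8 * h.
  by apply: le_trans lamh _; apply: ler_wpM2r => //; exact: le_trans C87.
have Wy0 := gap y0 cly0 lamC8 (le_trans y0xs C7h).
have Wy1 := gap y1 cly1 lamC8 y1xs.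
have PC8 := ler_wpM2l C30 (Phi_scale mw C8 h C81 h0).
have Eh : H * D ^+ 2 * Phi w lam1 <= H * D ^+ 2 * (kap^-1 * kap^-1) * Phi w h.
  rewrite -[leRHS]mulrA; apply: ler_wpM2l => //.
  by apply: Phi_le => //; exact: ltW.
have z0y : f0 y0 = 0 := datum_bdry _ _ _ _ _ _ _ _ rf0 y0 cly0 nUy0.
have z1y : f1 y0 = 0 := datum_bdry _ _ _ _ _ _ _ _ rf1 y0 cly0 nUy0.
have -> : dot p y = (1 - s) * dot p y0 + s * dot p y1 by rewrite {1}yE1 dot_seg.
move: Wy0 Wy1; rewrite -C3E z1y z0y => Wy0 Wy1.
have Ph0 := Phi_ge0 mw h h0.
have [X XE X0] : exists2 X, X = C3 * (C8 * C8 * Phi w h) & 0 <= X.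
  by exists (C3 * (C8 * C8 * Phi w h)); rewrite // mulrA mulr_ge0.
have [Y YE Y0] : exists2 Y, Y = H * D ^+ 2 * (kap^-1 * kap^-1) * Phi w h & 0 <= Y.
  by exists (H * D ^+ 2 * (kap^-1 * kap^-1) * Phi w h); rewrite // mulr_ge0.
have XE' : C3 * (C8 * C8) * 2 * Phi w h = 2 * X by rewrite XE; ring.
rewrite [X in _ <= _ + X]mulrDl XE' -YE.
have s10 : 0 <= 1 - s by rewrite subr_ge0 ltW.
(* The gap at time 1 over [y0] costs [X]; going back to time 0 changes the plane by [q], which costs
   [Y]. *)
have low0 : - (dot p y0 + c) <= X + Y.
  move: qE Wy0 PC8 Eh; rewrite ler_norml -XE -YE; clear - oU mw dU rf0 rf1; lra.
have up1 : f1 y1 <= dot p y1 + q + c + X.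
  by move: Wy1 PC8; rewrite -XE; clear - oU mw dU rf0 rf1; lra.
have := ler_wpM2l (ltW s0) up1; have := ler_wpM2l s10 low0.
have := ler_wpM2r X0 (ltW s1); have := ler_wpM2r (addr_ge0 X0 Y0) (_ : 1 - s <= 1).
rewrite gerBl ltW // => /(_ isT).
by clear - oU mw dU rf0 rf1; lra.
Qed.

End ConvexCombinationEstimates.

(** * Uniform chord estimate away from the corners *)

Section RegionEstimate.
Context {R : realType} {n : nat} {U : set 'rV[R]_n} {o : 'rV[R]_n} {r0 D : R}
  {w : R -> R} {H M m : R}.
Hypothesis oU : open U.
Hypothesis mw : modulus w.
Hypothesis dU : ray_domain U o r0 D.
Implicit Types (x y p b : 'rV[R]_n) (f : 'rV[R]_n -> R) (G : 'rV[R]_n -> 'rV[R]_n).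

(** The threshold [r0 / K] is the value of [kap] for which the two regimes are complementary:
    [h < r0 / K * lam1] says exactly that [K * h] is less than the room [lam1 * r0] required by
    [near_estimate]. *)
Lemma half_mid_estimate f0 f1 G0 G1 (tau : R) :
  regular_datum U o w f0 G0 H M m -> regular_datum U o w f1 G1 H M m ->
  0 < tau <= 1 ->
  exists C e : R, [/\ 0 <= C, 0 < e &
  forall x0 x1 p (q c : R) b0 (lam0 : R) b1 (lam1 t s : R) y (h : R),
  touching U f0 f1 x0 x1 p q c ->
  closure U b0 -> ~ U b0 -> 0 <= lam0 <= 1 -> x0 = seg lam0 b0 o ->
  closure U b1 -> ~ U b1 -> 0 < lam1 <= 1 -> x1 = seg lam1 b1 o ->
  lam0 <= lam1 -> tau <= t <= 1 - tau -> 0 < s < 1 -> U y ->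
  `|y - seg t x0 x1| <= h -> `|s - t| <= h -> h <= e ->
  chord_below U f0 f1 p q c y s (C * Phi w h)].
Proof.
move=> rf0 rf1 tau01.
have [H0 _ _] := datum_const _ _ _ _ _ _ _ _ rf1.
have r01 := ray_r0 _ _ _ _ dU.
have D1 := ray_D _ _ _ _ dU.
have [sg [sg0 sg1 sgE]] : exists sg : R, [/\ 0 < sg, sg <= 1 & sg = tau / 2].
  by exists (tau / 2); split=> //; lra.
have [K K1 KE] : exists2 K : R, 1 <= K & K = (1 + D) / sg.
  by exists ((1 + D) / sg) => //; rewrite ler_pdivlMr //; lra.
have K0 : 0 < K by exact: lt_le_trans K1.
have kap01 : 0 < r0 / K <= 1.
  by rewrite divr_gt0 // ?ler_pdivrMr //; lra.
have [C [e [C0 e0 far]]] := far_estimate oU mw dU rf0 rf1 tau (r0 / K) tau01 kap01.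
exists (C + H * (K * K)), (Num.min e sg); split.
- by rewrite addr_ge0 // !mulr_ge0 // ltW.
- by rewrite lt_min e0 sg0.
move=> x0 x1 p q c b0 lam0 b1 lam1 t s y h tch clb0 nUb0 lam001 x0E clb1 nUb1
  lam101 x1E lam01 t01 s01 Uy yh sth; rewrite le_min => /andP[he hsg].
have h0 : 0 <= h by apply: le_trans sth.
have Ph0 := Phi_ge0 mw h h0.
have [lh|lh] := lerP (r0 / K * lam1) h.
  have fb : chord_below U f0 f1 p q c y s (C * Phi w h).
    exact: (far x0 x1 p q c b0 lam0 b1 lam1 t s y h).
  apply: chord_below_le fb; apply: ler_wpM2r => //.
  by rewrite lerDl !mulr_ge0 // ltW.
have nb : chord_below U f0 f1 p q c y s (H * Phi w (K * h)).
  rewrite KE; apply: (near_estimate oU mw dU rf1 sg x0 x1 p q c b1 lam1 t) => //.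
    by move: sth t01 s01; rewrite ler_norml; lra.
  rewrite -KE; have : K * h < K * (r0 / K * lam1) by rewrite ltr_pM2l.
  suff -> : K * (r0 / K * lam1) = lam1 * r0 by [].
  by field; rewrite gt_eqF.
apply: chord_below_le nb; rewrite mulrDl; apply: ler_wpDl; first by rewrite mulr_ge0.
by rewrite -(mulrA H); apply: ler_wpM2l => //; exact: (Phi_scale mw K h).
Qed.

(** For [t] this close to 1, [x1] is within [eta / 2] of a point with an [eta]-ball inside [U]. A
    smaller [lam1] than [eta / (2 * D)] would put the boundary point [b1] into that ball, so the
    room around [x1] is bounded below and [near_estimate] applies at every small scale. *)
Lemma half_edge_estimate f0 f1 G0 G1 (eta : R) :
  regular_datum U o w f0 G0 H M m -> regular_datum U o w f1 G1 H M m ->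
  0 < eta ->
  exists C e : R, [/\ 0 <= C, 0 < e &
  forall x0 x1 p (q c t s : R) y (h : R),
  touching U f0 f1 x0 x1 p q c ->
  (forall v, `|v| < eta -> U (seg t x0 x1 + v)) -> t <= 1 ->
  1 - eta / (2 * D) <= t -> 3 / 4 <= t -> 0 < s < 1 -> U y ->
  `|y - seg t x0 x1| <= h -> `|s - t| <= h -> h <= e ->
  chord_below U f0 f1 p q c y s (C * Phi w h)].
Proof.
move=> rf0 rf1 eta0.
have [H0 _ _] := datum_const _ _ _ _ _ _ _ _ rf1.
have r01 := ray_r0 _ _ _ _ dU.
have D1 := ray_D _ _ _ _ dU.
have [d [d0 dE]] : exists d : R, 0 < d /\ d = eta / (2 * D).
  by exists (eta / (2 * D)); rewrite divr_gt0 //; lra.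
have [K K1 KE] : exists2 K : R, 1 <= K & K = (1 + D) / 2^-1.
  by exists ((1 + D) / 2^-1) => //; rewrite invrK; lra.
have K0 : 0 < K by exact: lt_le_trans K1.
exists (H * (K * K)), (Num.min (1 / 4) (d * r0 / 2 / K)); split.
- by rewrite !mulr_ge0 // ltW.
- rewrite lt_min; apply/andP; split; first lra.
  by rewrite !divr_gt0 // mulr_gt0 //; lra.
move=> x0 x1 p q c t s y h tch room t1 td t34 s01 Uy yh sth.
rewrite le_min => /andP[he hK].
have [cl0 cl1 _ _ _ _] := tch.
have h0 : 0 <= h by apply: le_trans sth.
have [b1 [lam1 [clb1 nUb1 lam101 x1E]]] := ray_dec _ _ _ _ dU x1 cl1.
have dist1 : `|x1 - seg t x0 x1| <= eta / 2.
  have -> : x1 - seg t x0 x1 = (1 - t) *: (x1 - x0).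
    by rewrite /seg; apply/rowP => i; rewrite !mxE; ring.
  rewrite normrZ ger0_norm ?subr_ge0 //.
  apply: (@le_trans _ _ (d * D)).
    by apply: ler_pM; rewrite ?subr_ge0 // ?(ray_diam _ _ _ _ dU) //; lra.
  suff -> : d * D = eta / 2 by [].
  by rewrite dE; field; lra.
have dlam : d <= lam1.
  rewrite leNgt; apply/negP => ld; apply: nUb1.
  have -> : b1 = seg t x0 x1 + (b1 - seg t x0 x1) by rewrite addrC subrK.
  apply: room; apply: le_lt_trans (norm_sub_trans _ x1 _) _.
  have : `|b1 - x1| <= lam1 * D by rewrite x1E; apply: (ray_dist dU) => //; lra.
  have : lam1 * D < d * D by rewrite ltr_pM2r //; lra.
  have -> : d * D = eta / 2 by rewrite dE; field; lra.
  lra.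
have nb : chord_below U f0 f1 p q c y s (H * Phi w (K * h)).
  rewrite KE; apply: (near_estimate oU mw dU rf1 2^-1 x0 x1 p q c b1 lam1 t) => //.
  - by move: d0 dlam lam101; lra.
  - by move: sth he t34 s01; rewrite ler_norml; lra.
  - rewrite -KE.
    have : d * r0 <= lam1 * r0 by apply: ler_wpM2r => //; lra.
    have : 0 < d * r0 by rewrite mulr_gt0 //; lra.
    by move: hK; rewrite ler_pdivlMr //; lra.
apply: chord_below_le nb; rewrite -(mulrA H); apply: ler_wpM2l => //.
exact: (Phi_scale mw K h).
Qed.

Lemma region_estimate f0 f1 G0 G1 (eta : R) :
  regular_datum U o w f0 G0 H M m -> regular_datum U o w f1 G1 H M m ->
  0 < eta ->
  exists C e : R, [/\ 0 <= C, 0 < e &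
  forall x0 x1 p (q c t s : R) y (h : R),
  touching U f0 f1 x0 x1 p q c -> U x0 \/ U x1 ->
  (eta <= t <= 1 - eta \/ forall v, `|v| < eta -> U (seg t x0 x1 + v)) ->
  0 < t < 1 -> 0 < s < 1 -> U y ->
  `|y - seg t x0 x1| <= h -> `|s - t| <= h -> h <= e ->
  chord_below U f0 f1 p q c y s (C * Phi w h)].
Proof.
move=> rf0 rf1 eta0.
have D1 := ray_D _ _ _ _ dU.
(* By [tau <= eta], a time outside [[tau, 1 - tau]] leaves only the alternative with an [eta]-ball;
   the other two bounds place such a time within reach of the edge estimate, after time reversal if
   it is near 0. *)
have [tau tau0 [tau14 taueta tauD]] : exists2 tau : R, 0 < tau &
    [/\ tau <= 1 / 4, tau <= eta & tau <= eta / (2 * D)].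
  exists (Num.min (1 / 4) (Num.min eta (eta / (2 * D)))).
    by rewrite !lt_min eta0 divr_gt0 //= ?divr_gt0 //; lra.
  by split; rewrite !ge_min lexx ?orbT.
have tau01 : 0 < tau <= 1 by lra.
have [C1 [e1 [C10 e10 mid1]]] := half_mid_estimate f0 f1 G0 G1 tau rf0 rf1 tau01.
have [C2 [e2 [C20 e20 mid2]]] := half_mid_estimate f1 f0 G1 G0 tau rf1 rf0 tau01.
have [C3 [e3 [C30 e30 edge1]]] := half_edge_estimate f0 f1 G0 G1 eta rf0 rf1 eta0.
have [C4 [e4 [C40 e40 edge2]]] := half_edge_estimate f1 f0 G1 G0 eta rf1 rf0 eta0.
exists (C1 + C2 + C3 + C4), (Num.min (Num.min e1 e2) (Num.min e3 e4)); split.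
- by rewrite !addr_ge0.
- by rewrite !lt_min e10 e20 e30.
move=> x0 x1 p q c t s y h tch U01 reg t01 s01 Uy yh sth.
rewrite !le_min => /andP[/andP[h1 h2] /andP[h3 h4]].
have h0 : 0 <= h by apply: le_trans sth.
have Ph0 := Phi_ge0 mw h h0.
have tch' := touchingC _ _ _ _ _ _ _ _ tch.
have yh' : `|y - seg (1 - t) x1 x0| <= h by rewrite -segC.
have sth' : `|(1 - s) - (1 - t)| <= h.
  suff -> : (1 - s) - (1 - t) = - (s - t) by rewrite normrN.
  by ring.
have s01' : 0 < 1 - s < 1 by move: s01; clear - oU mw dU H M m; lra.
have CP C' : C' <= C1 + C2 + C3 + C4 ->
    C' * Phi w h <= (C1 + C2 + C3 + C4) * Phi w h by exact: ler_wpM2r.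
have [tmid|ntmid] := boolP (tau <= t <= 1 - tau).
  have [cl0 cl1 _ _ _ _] := tch.
  have [b0 [lam0 [clb0 nUb0 lam001 x0E]]] := ray_dec _ _ _ _ dU x0 cl0.
  have [b1 [lam1 [clb1 nUb1 lam101 x1E]]] := ray_dec _ _ _ _ dU x1 cl1.
  have pos : 0 < lam0 \/ 0 < lam1.
    case: U01 => Ux; [left|right].
      by apply/(ray_inside dU b0 lam0) => //; rewrite -x0E.
    by apply/(ray_inside dU b1 lam1) => //; rewrite -x1E.
  have [l01|l10] := lerP lam0 lam1.
    apply: (chord_below_le _ _ _ _ _ _ _ _ _ _ (CP C1 _)).
    by move: C10 C20 C30 C40; clear - oU mw dU H M m; lra.
    apply: (mid1 x0 x1 p q c b0 lam0 b1 lam1 t s y h) => //.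
    by case: pos => pos; move: pos l01 lam101; clear - oU mw dU H M m; lra.
  apply: chord_belowC; apply: (chord_below_le _ _ _ _ _ _ _ _ _ _ (CP C2 _)).
    by move: C10 C20 C30 C40; clear - oU mw dU H M m; lra.
  by apply: (mid2 x1 x0 p (- q) (q + c) b1 lam1 b0 lam0 (1 - t) (1 - s) y h) => //;
    move: l10 lam001 lam101 tmid; clear - oU mw dU H M m; lra.
have room : forall v, `|v| < eta -> U (seg t x0 x1 + v).
  case: reg => // tt; case/negP: ntmid.
  by move: tt taueta; clear - oU mw dU H M m; lra.
have tout : t < tau \/ 1 - tau < t.
  by move: ntmid; rewrite negb_and -!ltNge => /orP[?|?]; [left|right].
have [t34|t34] := lerP t (3 / 4).
  apply: chord_belowC; apply: (chord_below_le _ _ _ _ _ _ _ _ _ _ (CP C4 _)).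
    by move: C10 C20 C30 C40; clear - oU mw dU H M m; lra.
  apply: (edge2 x1 x0 p (- q) (q + c) (1 - t) (1 - s) y h) => //.
  - by rewrite -segC.
  - by move: t01; clear - oU mw dU H M m; lra.
  - by case: tout => tt; move: tt t34 tau14 tauD; clear - oU mw dU H M m; lra.
  - by case: tout => tt; move: tt t34 tau14; clear - oU mw dU H M m; lra.
apply: (chord_below_le _ _ _ _ _ _ _ _ _ _ (CP C3 _)).
  by move: C10 C20 C30 C40; clear - oU mw dU H M m; lra.
apply: (edge1 x0 x1 p q c t s y h) => //.
- by move: t01; clear - oU mw dU H M m; lra.
- by case: tout => tt; move: tt t34 tau14 tauD; clear - oU mw dU H M m; lra.
- exact: ltW.
Qed.

End RegionEstimate.

Lemma powR_modulus {R : realType} (alpha : R) : 0 < alpha <= 1 ->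
  modulus (fun r => r `^ alpha).
Proof.
move=> /andP[a0 a1]; split=> [r r0|r r0|r s r0 rs|K r K1 r0|e e0].
- exact: powR_ge0.
- exact: powR_gt0.
- by apply: ge0_ler_powR; rewrite ?nnegrE ?(ltW a0) // (le_trans r0).
- have K0 : 0 <= K := le_trans ler01 K1.
  rewrite powRM //; apply: ler_wpM2r; first exact: powR_ge0.
  by rewrite -[leRHS]powRr1 //; exact: ler_powR.
- have e20 : 0 < e / 2 by rewrite divr_gt0.
  exists ((e / 2) `^ alpha^-1); first exact: powR_gt0.
  rewrite -powRrM mulVf ?gt_eqF // powRr1 ?ltW //.
  by rewrite ltr_pdivrMr //; move: e0; lra.
Qed.

(** * Geometry of strictly convex domains, and the sign of the data *)

Section ConvexDomain.
Context {R : realType} {n : nat} {U : set 'rV[R]_n}.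
Implicit Types (x y v o b : 'rV[R]_n).
Hypothesis scd : strictly_convex_domain U.

Lemma scd_star x y (s : R) : closure U x -> U y -> 0 < s <= 1 -> U (seg s x y).
Proof.
move=> clx Uy /andP[s0 s1]; have [_ _ _ sc] := scd.
have [->|xy] := eqVneq x y; first by rewrite segxx.
have [->|s1'] := eqVneq s 1; first by rewrite seg1.
have := sc x y (1 - s) clx (subset_closure Uy) xy.
rewrite /seg opprB addrCA subrr addr0; apply.
by rewrite subr_gt0 lt_neqAle s1' s1 gtrBl.
Qed.

Lemma scd_convex_closure x y (s : R) : closure U x -> closure U y -> 0 <= s <= 1 ->
  closure U (seg s x y).
Proof.
have [[ctr Uc] _ cU _] := scd.
by apply: (@star_closure_seg _ _ U ctr) => // z e clz e01; exact: scd_star.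
Qed.

Hypothesis bU : bounded_set U.

(** The exit time is the supremum of the times at which the ray is in the closure. All earlier
    points lie in [U] by shrinking towards [o], so the supremum is attained; openness would prolong
    the ray if the exit point were in [U]. *)
Lemma exit_point o v : U o -> v != 0 -> exists2 s : R, 0 < s &
  [/\ closure U (o + s *: v), ~ U (o + s *: v) &
      forall s', closure U (o + s' *: v) -> s' <= s].
Proof.
move=> Uo v0; have [_ oU _ _] := scd.
have [D D0 diam] := bounded_closure_diam U bU.
have nv0 : 0 < `|v| by rewrite normr_gt0.
pose S : set R := [set s : R | closure U (o + s *: v)].
have segE (s e : R) : o + ((1 - e) * s) *: v = seg e (o + s *: v) o.
  by rewrite /seg; apply/rowP => i; rewrite !mxE; ring.
have S0 : S 0 by rewrite /S /= scale0r addr0; exact: subset_closure.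
have Sub : ubound S (D / `|v|).
  move=> s Ss; rewrite ler_pdivlMr //; apply: (@le_trans _ _ (`|s| * `|v|)).
    by rewrite ler_wpM2r // ler_norm.
  rewrite -normrZ; have -> : s *: v = o + s *: v - o by rewrite addrAC subrr add0r.
  by apply: diam => //; exact: subset_closure.
have supS : has_sup S by split; [exists 0 | exists (D / `|v|)].
have near s : U (o + s *: v) -> exists2 d : R, 0 < d & S (s + d).
  move=> Us; have /nbhs_ballP[d /= d0 dB] := open_nbhs_nbhs (conj oU Us).
  exists (d / 2 / `|v|); first by rewrite !divr_gt0.
  rewrite /S /=; apply: subset_closure; apply: dB; rewrite -ball_normE /=.
  rewrite scalerDl addrA opprD addrA subrr add0r normrN normrZ gtr0_norm ?divr_gt0 //.
  by rewrite divfK ?gt_eqF // ltr_pdivrMr //; move: d0; lra.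
have inside s : 0 <= s -> s < sup S -> U (o + s *: v).
  move=> s0 sS; have dS : 0 < sup S - s by rewrite subr_gt0.
  have [s' Ss' ss'] := sup_adherent dS supS.
  move: ss'; rewrite opprB addrCA subrr addr0 => ss'.
  have s'0 : 0 < s' by exact: le_lt_trans ss'.
  have -> : s = (1 - (1 - s / s')) * s' by field; rewrite gt_eqF.
  rewrite segE; apply: scd_star => //.
  by rewrite subr_gt0 ltr_pdivrMr // mul1r ss' gerBl divr_ge0 // ltW.
have sup0 : 0 < sup S.
  have [|d d0 Sd] := near 0; first by rewrite scale0r addr0.
  by have := sup_upper_bound supS Sd; rewrite add0r; exact: lt_le_trans.
exists (sup S); first exact: sup0.
split.
- apply: (closure_seg U _ o) => e /andP[e0 e1]; rewrite -segE; apply: inside.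
    by rewrite mulr_ge0 ?subr_ge0 // ltW.
  by rewrite gtr_pMl // gtrBl.
- move=> /near[d d0 Sd]; have := sup_upper_bound supS Sd.
  by rewrite gerDl leNgt d0.
- by move=> s' Ss'; exact: sup_upper_bound.
Qed.

Hypothesis n0 : (0 < n)%N.

Lemma exists_nonzero : exists v : 'rV[R]_n, v != 0.
Proof.
exists (delta_mx 0 (Ordinal n0)); apply/eqP => /rowP /(_ (Ordinal n0)).
by rewrite !mxE !eqxx => /eqP; rewrite oner_eq0.
Qed.

Lemma scd_dec o x : U o -> closure U x -> exists b (lam : R),
  [/\ closure U b, ~ U b, 0 <= lam <= 1 & x = seg lam b o].
Proof.
move=> Uo clx; have [->|xo] := eqVneq x o.
  have [v v0] := exists_nonzero; have [s _ [clb nUb _]] := exit_point o v Uo v0.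
  by exists (o + s *: v), 1; rewrite seg1 lexx ler01.
have v0 : x - o != 0 by rewrite subr_eq0.
have [s s0 [clb nUb smax]] := exit_point o (x - o) Uo v0.
have s1 : 1 <= s by apply: smax; rewrite scale1r addrC subrK.
exists (o + s *: (x - o)), (1 - s^-1); split=> //.
  by rewrite subr_ge0 invf_le1 // s1 gerBl invr_ge0 ltW.
by rewrite /seg; apply/rowP => i; rewrite !mxE; field; rewrite gt_eqF.
Qed.

Lemma scd_ray_domain : exists o (r0 D : R), ray_domain U o r0 D.
Proof.
have [[ctr Uc] oU cU sc] := scd.
have [D D0 diam] := bounded_closure_diam U bU.
have /nbhs_ballP[r /= rp rB] := open_nbhs_nbhs (conj oU Uc).
exists ctr, (Num.min r 1), (Num.max D 1); split.
- by rewrite lt_min rp ltr01 ge_min lexx orbT.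
- by rewrite le_max lexx orbT.
- move=> v; rewrite lt_min => /andP[vr _]; apply: rB.
  by rewrite -ball_normE /= opprD addrA subrr add0r normrN.
- exact: scd_star.
- exact: scd_convex_closure.
- by move=> x y clx cly; rewrite le_max diam.
- by move=> x; exact: scd_dec.
Qed.

(* A point of U lies between two boundary points. *)
Lemma convex_le0 f x : {within closure U, continuous f} -> convex_function U f ->
  (forall y, bdry U y -> f y = 0) -> U x -> f x <= 0.
Proof.
move=> cf cvf f0 Ux; have [_ oU cU _] := scd.
have [v v0] := exists_nonzero.
have [s s0 [cls nUs _]] := exit_point x v Ux v0.
have [s' s'0 [cls' nUs' _]] : exists2 s' : R, 0 < s' &
    [/\ closure U (x - s' *: v), ~ U (x - s' *: v) & True].
  have [|s' s'0 [cls' nUs' _]] := exit_point x (- v) Ux; first by rewrite oppr_eq0.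
  rewrite scalerN in cls' nUs'.
  by exists s'; [exact: s'0 | split; [exact: cls' | exact: nUs' | exact: I]].
have ss0 : 0 < s + s' by rewrite addr_gt0.
have xE : x = seg (s / (s + s')) (x + s *: v) (x - s' *: v).
  by rewrite /seg; apply/rowP => i; rewrite !mxE; field; rewrite gt_eqF.
have t01 : 0 <= s / (s + s') <= 1.
  apply/andP; split; first by rewrite divr_ge0 // ltW.
  by rewrite ler_pdivrMr // mul1r lerDl ltW.
have := convex_function_closure (fun z e clz => scd_star z x e clz Ux) f _ _ _
  cU cvf cf cls cls' t01.
have z1 : f (x + s *: v) = 0 by apply/f0/(bdry_openE _ _ oU).
have z2 : f (x - s' *: v) = 0 by apply/f0/(bdry_openE _ _ oU).
by rewrite -xE z1 z2 !mulr0 addr0.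
Qed.

(** If [f x = 0], the values of the support function at [x + k v] and [x - k v] are at most [f <= 0]
    and add up to 0. Hence both vanish and contact also occurs at [x + k v], against strict
    convexity at [x]. *)
Lemma strictly_convex_lt0 f x : {within closure U, continuous f} ->
  strictly_convex_on U f -> (forall y, bdry U y -> f y = 0) -> U x -> f x < 0.
Proof.
move=> cf [cvf scf] f0 Ux; have [_ oU cU _] := scd.
have le0 y : U y -> f y <= 0 by exact: convex_le0.
rewrite lt_neqAle le0 // andbT; apply/eqP => fx0.
have [l [[[p [c lE]] lf fl] fE]] := scf x Ux.
have [v v0] := exists_nonzero.
have /nbhs_ballP[r /= r0 rB] := open_nbhs_nbhs (conj oU Ux).
have nv0 : 0 < `|v| by rewrite normr_gt0.
pose k := r / 2 / `|v|.
have k0 : 0 < k by rewrite !divr_gt0.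
have nk : `|k *: v| < r.
  by rewrite normrZ gtr0_norm // divfK ?gt_eqF // ltr_pdivrMr //; move: r0; lra.
have U1 : U (x + k *: v).
  by apply: rB; rewrite -ball_normE /= opprD addrA subrr add0r normrN.
have U2 : U (x - k *: v).
  by apply: rB; rewrite -ball_normE /= opprB addrCA subrr addr0.
have : [set y | U y /\ f y = l y] (x + k *: v).
  split=> //; have := lf _ U1; have := lf _ U2; have := le0 _ U1; have := le0 _ U2.
  move: fl fx0; rewrite !lE !dotDr dotNr; lra.
rewrite fE /= => /eqP; rewrite -subr_eq0 addrAC subrr add0r scaler_eq0.
by rewrite gt_eqF // (negbTE v0).
Qed.

End ConvexDomain.

Lemma ereal_sup_finite_bound {R : realType} {T : Type} (A : set T) (g : T -> R) :
  A !=set0 -> (forall x, 0 <= g x) ->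
  (ereal_sup [set (g x)%:E | x in A] < +oo)%E ->
  exists2 M : R, 0 <= M & forall x, A x -> g x <= M.
Proof.
move=> [a Aa] g0 sfin.
have ub x : A x -> ((g x)%:E <= ereal_sup [set (g x)%:E | x in A])%E.
  by move=> Ax; apply: ereal_sup_ubound; exists x.
have := ub a Aa; move: sfin ub; case: (ereal_sup _) => [M| |] //= _ ub ga.
by exists M => [|x /ub]; [exact: le_trans (g0 a) ga | rewrite lee_fin].
Qed.

Lemma ge0_adde_lt_pinfty {R : realType} (a b : \bar R) :
  (0 <= a -> 0 <= b -> a + b < +oo -> a < +oo /\ b < +oo)%E.
Proof. by case: a => [a| |]; case: b => [b| |] //=; rewrite !ltry. Qed.

(** * Finite norms as explicit bounds *)

Section Norms.
Context {R : realType} {n : nat}.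
Implicit Types (E : set 'rV[R]_n) (f : 'rV[R]_n -> R) (x y : 'rV[R]_n).

(** On a nonempty set all three suprema are nonnegative, so finiteness of their sum makes each of
    them finite. *)
Lemma C1a_norm_finite_bound (a : R) f E : E !=set0 -> (C1a_norm a f E < +oo)%E ->
  exists B M H : R, [/\ [/\ 0 <= B, 0 <= M & 0 <= H],
    forall x, E x -> `|f x| <= B,
    forall x, E x -> `|grad f x| <= M &
    forall x y, E x -> E y -> `|grad f x - grad f y| <= H * `|x - y| `^ a].
Proof.
move=> [e Ee].
have sup0 (T : Type) (A : set T) (g : T -> R) z : A z -> 0 <= g z ->
    (0 <= ereal_sup [set (g x)%:E | x in A])%E.
  move=> Az gz; apply: (@le_trans _ _ (g z)%:E); first by rewrite lee_fin.
  by apply: ereal_sup_ubound; exists z.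
pose hq (p : 'rV[R]_n * 'rV[R]_n) : R :=
  `|grad f p.1 - grad f p.2| / (`|p.1 - p.2| `^ a).
have hq0 p : 0 <= hq p by rewrite divr_ge0 ?powR_ge0.
have sf := sup0 _ E (fun x => `|f x|) e Ee (normr_ge0 _).
have sg := sup0 _ E (fun x => `|grad f x|) e Ee (normr_ge0 _).
have sh := sup0 _ (E `*` E) hq (e, e) (conj Ee Ee) (hq0 _).
move=> /(ge0_adde_lt_pinfty _ _ (adde_ge0 sf sg) sh)[].
move=> /(ge0_adde_lt_pinfty _ _ sf sg)[ffin gfin] hfin.
have E0 : E !=set0 by exists e.
have [B B0 fB] := ereal_sup_finite_bound _ _ E0 (fun x => normr_ge0 (f x)) ffin.
have [M M0 gM] := ereal_sup_finite_bound _ _ E0 (fun x => normr_ge0 (grad f x)) gfin.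
have EE0 : E `*` E !=set0 by exists (e, e).
have [H H0 hH] := ereal_sup_finite_bound _ _ EE0 hq0 hfin.
exists B, M, H; split=> // x y Ex Ey.
have [->|xy] := eqVneq x y; first by rewrite subrr normr0 mulr_ge0 ?powR_ge0.
have := hH (x, y) (conj Ex Ey); rewrite /hq /= ler_pdivrMr //.
by rewrite powR_gt0 // normr_gt0 subr_eq0.
Qed.

Lemma C1a_norm_lt_pinfty (a B M H : R) f E :
  (forall x, E x -> `|f x| <= B) -> (forall x, E x -> `|grad f x| <= M) ->
  (forall x y, E x -> E y -> `|grad f x - grad f y| <= H * `|x - y| `^ a) ->
  (C1a_norm a f E < +oo)%E.
Proof.
move=> fB gM hH.
(* No sign is assumed on [H], while a diagonal pair contributes 0; hence the bound by the absolute
   value. *)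
have H0 : 0 <= `|H| by [].
rewrite /C1a_norm /C1_norm !lte_add_pinfty //.
- by apply: (@le_lt_trans _ _ B%:E); [|exact: ltry]; apply: ge_ereal_sup => _ [x Ex <-]; rewrite lee_fin fB.
- by apply: (@le_lt_trans _ _ M%:E); [|exact: ltry]; apply: ge_ereal_sup => _ [x Ex <-]; rewrite lee_fin gM.
apply: (@le_lt_trans _ _ `|H|%:E); last exact: ltry.
apply: ge_ereal_sup => _ [[x y] [Ex Ey] <-] /=; rewrite lee_fin.
have [->|xy] := eqVneq x y; first by rewrite subrr normr0 mul0r.
rewrite ler_pdivrMr ?powR_gt0 ?normr_gt0 ?subr_eq0 //.
apply: le_trans (hH x y Ex Ey) _; apply: ler_wpM2r; first exact: powR_ge0.
exact: ler_norm.
Qed.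

Lemma diff_dot_grad f x v : differentiable f x -> 'd f x v = dot (grad f x) v.
Proof.
move=> df; rewrite [in LHS](row_sum_delta v) linear_sum /=.
by apply: eq_bigr => i _; rewrite linearZ /= !mxE deriveE // mulrC.
Qed.

Lemma convex_grad_le U f x y : convex_set U -> convex_function U f ->
  differentiable f x -> U x -> U y -> f x + dot (grad f x) (y - x) <= f y.
Proof.
move=> cU /convex_functionE cf df Ux Uy.
rewrite -diff_dot_grad // -deriveE // addrC -lerBrDr.
have cvd : (fun h : R => h^-1 *: (f (h *: (y - x) + x) - f x)) @ (0 : R)^'+ -->
    'D_(y - x) f x.
  have dcvg : (fun h : R => h^-1 *: (f (h *: (y - x) + x) - f x)) @ (0 : R)^' -->
      'D_(y - x) f x := @diff_derivable _ _ _ f x (y - x) df.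
  apply: cvg_trans dcvg; apply: cvg_app; apply: within_subset => z /=.
  by move=> z0; rewrite gt_eqF.
apply: (ler_cvg_to cvd (cvg_cst (f y - f x))).
apply: near_at_right01 => h /andP[h0 h1]; rewrite /GRing.scale /= ler_pdivrMl //.
have -> : h *: (y - x) + x = seg h x y by rewrite /seg; apply/rowP => i; rewrite !mxE; ring.
have h01 : 0 <= h <= 1 by rewrite ltW.
by have := cf h x y Ux Uy h01; lra.
Qed.

End Norms.

(** * Data of class [S_tilde] satisfy the Taylor bounds *)

Section Datum.
Context {R : realType} {n : nat} {U : set 'rV[R]_n}.
Implicit Types (x y v o b : 'rV[R]_n).

Lemma regular_datum_weaken o w f G (H M m H' M' m' : R) : modulus w ->
  H <= H' -> M <= M' -> 0 < m' -> m' <= m ->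
  regular_datum U o w f G H M m -> regular_datum U o w f G H' M' m'.
Proof.
move=> mw HH MM m'0 mm [[H0 M0 m0] cvf up low gr bd ce]; split=> //.
- by split=> //; [exact: le_trans HH | exact: le_trans MM].
- move=> x y Ux cly; apply: le_trans (up x y Ux cly) _; rewrite lerD2l.
  by apply: ler_wpM2r => //; exact: (Phi_ge0 mw).
- by move=> x Ux; apply: le_trans MM; exact: gr.
- by apply: le_trans ce _; rewrite lerN2.
Qed.

(** Convexity replaces the mean value theorem: the support plane at [z], read at [x], bounds [f z]
    by [f x + dot (grad f z) (z - x)], and the Hoelder bound trades [grad f z] for [grad f x]. The
    factor [n] comes from estimating [dot] in the maximum norm. *)
Lemma S_tilde_regular_datum (alpha : R) f o : (0 < n)%N ->
  strictly_convex_domain U -> bounded_set U -> 0 < alpha <= 1 -> U o ->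
  S_tilde alpha U f ->
  exists H M m B : R,
    regular_datum U o (fun r => r `^ alpha) f (grad f) H M m /\
    forall x, closure U x -> `|f x| <= B.
Proof.
move=> n0 scd bU a01 Uo [[C1f C1af] cf scf _ f0].
have mw := powR_modulus alpha a01.
have [_ oU cU _] := scd; have [cvf _] := scf.
have [|B [M [H [[B0 M0 H0] fB gM hH]]]] := C1a_norm_finite_bound alpha f U _ C1af.
  by exists o.
have starU z : U z -> forall x (s : R), closure U x -> 0 < s <= 1 -> U (seg s x z).
  by move=> Uz x s clx; exact: scd_star.
have f0' x : closure U x -> ~ U x -> f x = 0.
  by move=> clx nUx; apply/f0/(bdry_openE _ _ oU).
have neg : f o < 0 by exact: (strictly_convex_lt0 scd bU n0).
have low x y : U x -> closure U y -> f x + dot (grad f x) (y - x) <= f y.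
  move=> Ux cly.
  have := affine_le_closure (starU o Uo) f (grad f x) (f x - dot (grad f x) x) y cf _ cly.
  rewrite dotBr addrCA addrA addrC addrA; apply=> z Uz.
  have [df _] := C1f x Ux.
  by have := convex_grad_le U f x z cU cvf df Ux Uz; rewrite dotBr; lra.
exists (n%:R * H), M, (- f o), B; split; last first.
  move=> x clx; have [Ux|nUx] := pselect (U x); first exact: fB.
  by rewrite f0' // normr0.
split=> //.
- by split; rewrite ?mulr_ge0 ?oppr_gt0.
- move=> s x y clx cly s01.
  exact: (convex_function_closure (starU o Uo) f s x y cU cvf cf clx cly s01).
- move=> x y Ux cly; set C := _ * Phi _ _.
  (* For a boundary point [y] the gradient exists only at [seg e y x] with [e > 0]; the bound is
     proved there with a constant independent of [e], then [e] tends to 0. *)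
  have up e : 0 < e <= 1 -> f (seg e y x) <=
      dot (grad f x) (seg e y x) + (f x - dot (grad f x) x + C).
    move=> e01; have Uz := starU x Ux y e cly e01.
    have := low _ _ Uz (subset_closure Ux).
    have zx : seg e y x - x = (1 - e) *: (y - x).
      by rewrite /seg; apply/rowP => i; rewrite !mxE; ring.
    have nzx : `|seg e y x - x| <= `|y - x|.
      rewrite zx normrZ ger0_norm; last by lra.
      by apply: ler_piMl => //; lra.
    have : dot (grad f (seg e y x) - grad f x) (seg e y x - x) <= C.
      have -> : C = n%:R * (H * `|y - x| `^ alpha * `|y - x|) by rewrite /C /Phi; ring.
      apply: le_trans (dot_le _ _) _; rewrite -mulrA; apply: ler_wpM2l => //.
      apply: ler_pM => //; apply: le_trans (hH _ _ Uz Ux) _.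
      by apply: ler_wpM2l => //; apply: (modulus_mono _ mw).
    by rewrite dotBl !dotBr; lra.
  have lhs := star_cvg (starU x Ux) f y cf cly.
  have rhs : dot (grad f x) (seg e y x) + (f x - dot (grad f x) x + C)
      @[e --> (0 : R)^'+] --> dot (grad f x) y + (f x - dot (grad f x) x + C).
    apply: cvgD; last exact: cvg_cst.
    by apply: (cvg_comp _ _ (seg_cvg y x)); exact: continuous_dot.
  have := ler_cvg_to lhs rhs (near_at_right01 _ up) => /(_ (at_right_proper_filter _)).
  by rewrite dotBr; lra.
- by rewrite opprK.
Qed.

End Datum.

(** * Minimisers and their touching planes *)

Section Touching.
Context {R : realType} {n : nat} {U : set 'rV[R]_n} {o : 'rV[R]_n} {r0 D : R}
  {w : R -> R} {H M m : R}.
Hypothesis oU : open U.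
Hypothesis mw : modulus w.
Hypothesis dU : ray_domain U o r0 D.
Implicit Types (x y a b p : 'rV[R]_n) (f : 'rV[R]_n -> R) (G : 'rV[R]_n -> 'rV[R]_n).

(* The variation a = x0 - e v, b = x1 + e (b - x1), with v chosen so that seg t a b
   is fixed, turns minimality into the support inequality for f1. *)
Lemma touching_of_min f0 f1 G0 G1 x0 x1 (t : R) :
  regular_datum U o w f0 G0 H M m -> regular_datum U o w f1 G1 H M m ->
  U x0 -> closure U x1 -> 0 < t < 1 ->
  (forall a b, closure U a -> closure U b -> seg t a b = seg t x0 x1 ->
    (1 - t) * f0 x0 + t * f1 x1 <= (1 - t) * f0 a + t * f1 b) ->
  exists p (q c : R), touching U f0 f1 x0 x1 p q c /\ `|p| <= M.
Proof.
move=> rf0 rf1 Ux0 cl1 /andP[t0 t1] mini.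
have [H0 _ _] := datum_const _ _ _ _ _ _ _ _ rf0.
have t1' : 0 < 1 - t by rewrite subr_gt0.
pose p := G0 x0; pose c := f0 x0 - dot p x0; pose q := f1 x1 - dot p x1 - c.
exists p, q, c; split; last exact: (datum_grad _ _ _ _ _ _ _ _ rf0).
split=> //; first exact: subset_closure.
- move=> y cly; have := datum_lower _ _ _ _ _ _ _ _ rf0 x0 y Ux0 cly.
  by rewrite dotBr /c -/p; lra.
- move=> b clb; rewrite leNgt; apply/negP => lt_b.
  pose d := f1 x1 + dot p (b - x1) - f1 b.
  have d0 : 0 < d by rewrite /d dotBr; move: lt_b; rewrite /q; lra.
  pose v := (t / (1 - t)) *: (b - x1).
  have pv : (1 - t) * dot p v = t * dot p (b - x1).
    by rewrite /v dotZr; field; rewrite gt_eqF.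
  have /nbhs_ballP[r1 /= r10 rB] := open_nbhs_nbhs (conj oU Ux0).
  pose k := (1 - t) * H * `|v|.
  have k0 : 0 <= k by rewrite !mulr_ge0 // ltW.
  have k10 : 0 < k + 1 by exact: ltr_wpDl.
  have [r2 r20 wr2] := modulus_small _ mw (t * d / (k + 1))
    (divr_gt0 (mulr_gt0 t0 d0) k10).
  have v10 : 0 < `|v| + 1 by exact: ltr_wpDl.
  (* [r1] keeps [x0 - e v] inside [U]. [r2] makes the Taylor error, at most [e * (k * w r2)],
     smaller than the first-order gain [e * (t * d)] of the variation. *)
  pose e := Num.min 1 (Num.min r1 r2 / (`|v| + 1)).
  have e0 : 0 < e by rewrite lt_min ltr01 divr_gt0 // lt_min r10.
  have e1 : e <= 1 by rewrite ge_min lexx.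
  have ev : e * `|v| < Num.min r1 r2.
    apply: (@lt_le_trans _ _ (e * (`|v| + 1))); first by rewrite ltr_pM2l // ltrDl.
    by rewrite -ler_pdivlMr // ge_min lexx orbT.
  have /andP[ev1 ev2] : (e * `|v| < r1) && (e * `|v| < r2) by rewrite -lt_min.
  have nev : `|- (e *: v)| = e * `|v| by rewrite normrN normrZ gtr0_norm.
  have Ua : U (x0 - e *: v).
    by apply: rB; rewrite -ball_normE /= opprB addrCA subrr addr0 -normrN nev.
  have e01 : 0 <= e <= 1 by rewrite ltW.
  have clbe := ray_convex _ _ _ _ dU x1 b e cl1 clb e01.
  have := mini _ _ (subset_closure Ua) clbe.
  have -> : seg t (x0 - e *: v) (seg e x1 b) = seg t x0 x1.
    by rewrite /seg /v; apply/rowP => i; rewrite !mxE; field; rewrite gt_eqF.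
  move=> /(_ erefl).
  have := datum_upper _ _ _ _ _ _ _ _ rf0 x0 _ Ux0 (subset_closure Ua).
  rewrite [x0 - _ - x0]addrAC subrr add0r nev dotNr dotZr -/p => fa.
  have fb := datum_convex _ _ _ _ _ _ _ _ rf1 e x1 b cl1 clb e01.
  have := ler_wpM2l (ltW t1') fa; have := ler_wpM2l (ltW t0) fb.
  have PhiE : (1 - t) * (H * Phi w (e * `|v|)) <= e * (k * w r2).
    have -> : (1 - t) * (H * Phi w (e * `|v|)) = e * (k * w (e * `|v|)).
      by rewrite /Phi /k; ring.
    apply: ler_wpM2l; first exact: ltW.
    apply: ler_wpM2l => //; apply: (modulus_mono _ mw); last exact: ltW.
    by rewrite mulr_ge0 // ltW.
  have kw : k * w r2 < t * d.
    move: wr2; rewrite ltr_pdivlMr // mulrDr mulr1 mulrC.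
    by have := modulus_gt0 _ mw _ r20; lra.
  have := ltr_pM2l e0 (k * w r2) (t * d); rewrite kw => /idP.
  have := congr1 (fun z => e * z) pv => /=.
  move: PhiE; rewrite /d; clear - oU mw dU; lra.
- by rewrite /c; lra.
- by rewrite /q; lra.
Qed.

(** The second endpoint is the function [sg] of the first, so the minimum is over a compact set of
    first endpoints. Two boundary endpoints would give the value 0, but the competitor [(x, x)] has
    a negative value; so one endpoint is interior, and time reversal covers the case where it is the
    second. *)
Lemma exists_touching f0 f1 G0 G1 x (t : R) :
  regular_datum U o w f0 G0 H M m -> regular_datum U o w f1 G1 H M m ->
  {within closure U, continuous f0} -> {within closure U, continuous f1} ->
  compact (closure U) -> U x -> 0 < t < 1 ->
  exists x0 x1 p (q c : R), [/\ touching U f0 f1 x0 x1 p q c,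
    x = seg t x0 x1, U x0 \/ U x1 & `|p| <= M].
Proof.
move=> rf0 rf1 cf0 cf1 cptU Ux t01; have /andP[t0 t1] := t01.
have t1' : 0 < 1 - t by rewrite subr_gt0.
pose sg (a : 'rV[R]_n) : 'rV[R]_n := t^-1 *: (x - (1 - t) *: a).
have csg : continuous sg.
  move=> a; apply: (@cvgZl_tmp _ _ _ (nbhs a)); apply: (@cvgB _ _ _ (nbhs a)).
    exact: cvg_cst.
  by apply: (@cvgZl_tmp _ _ _ (nbhs a)); exact: cvg_id.
have sgE a : seg t a (sg a) = x.
  by rewrite /seg /sg; apply/rowP => i; rewrite !mxE; field; rewrite gt_eqF.
have sg_uniq a b : seg t a b = x -> b = sg a.
  by move=> xE; rewrite /sg -xE /seg; apply/rowP => i; rewrite !mxE; field; rewrite gt_eqF.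
pose K := closure U `&` sg @^-1` closure U.
have cptK : compact K.
  apply: subclosed_compact cptU _; last by move=> a [].
  apply: closedI; first exact: closed_closure.
  by apply: preimage_closed => [a _|]; [exact: csg | exact: closed_closure].
pose g a := (1 - t) * f0 a + t * f1 (sg a).
have cg : {within K, continuous g}.
  apply/subspace_continuousP => a [cla clsa]; apply: cvgD; apply: cvgMl_tmp.
    have /subspace_continuousP /(_ a cla) := cf0; apply: cvg_trans.
    by apply: cvg_app; apply: within_subset => z [].
  have /subspace_continuousP /(_ (sg a) clsa) := cf1.
  apply: cvg_comp => P /= wP.
  have : nbhs a (sg @^-1` [set z | closure U z -> P z]) := csg a _ wP.
  by rewrite /within /=; apply: filterS => z hz [_ clsz]; exact: hz.
have sgx : sg x = x by apply/esym/sg_uniq; rewrite segxx.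
have Kx : K x by split; rewrite /= ?sgx; exact: subset_closure.
have [|x0 /set_mem[cl0 cl1] gmin] := compact_EVT_min _ cptK cg; first by exists x.
have mini a b : closure U a -> closure U b -> seg t a b = seg t x0 (sg x0) ->
    (1 - t) * f0 x0 + t * f1 (sg x0) <= (1 - t) * f0 a + t * f1 b.
  move=> cla clb; rewrite sgE => /sg_uniq bE; rewrite bE in clb *.
  by apply: gmin; rewrite inE.
have neg f G : regular_datum U o w f G H M m -> f x < 0.
  move=> rf; have [_ _ m0] := datum_const _ _ _ _ _ _ _ _ rf.
  have [b [lam [clb nUb lam01 xE]]] := ray_dec _ _ _ _ dU x (subset_closure Ux).
  have lam0 : 0 < lam by apply/(ray_inside dU b lam) => //; rewrite -xE.
  have clo : closure U o.
    apply: subset_closure; rewrite -(addr0 o); apply: (ray_ball _ _ _ _ dU).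
    by rewrite normr0; case/andP: (ray_r0 _ _ _ _ dU).
  have := datum_convex _ _ _ _ _ _ _ _ rf lam b o clb clo lam01.
  rewrite -xE (datum_bdry _ _ _ _ _ _ _ _ rf b clb nUb) mulr0 add0r.
  have := datum_center _ _ _ _ _ _ _ _ rf => fo; move=> fx; apply: le_lt_trans fx _.
  by rewrite pmulr_rlt0 //; apply: le_lt_trans fo _; rewrite oppr_lt0.
exists x0, (sg x0).
have [U0|nU0] := pselect (U x0).
  have [p [q [c [tch pM]]]] := touching_of_min f0 f1 G0 G1 x0 (sg x0) t rf0 rf1 U0 cl1 t01 mini.
  by exists p, q, c; split; [exact: tch | rewrite sgE | left | exact: pM].
have [U1|nU1] := pselect (U (sg x0)).
  have t01' : 0 < 1 - t < 1 by rewrite t1' gtrBl.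
  have mini' a b : closure U a -> closure U b -> seg (1 - t) a b = seg (1 - t) (sg x0) x0 ->
      (1 - (1 - t)) * f1 (sg x0) + (1 - t) * f0 x0 <=
      (1 - (1 - t)) * f1 a + (1 - t) * f0 b.
    move=> cla clb; rewrite -!segC opprB addrCA subrr addr0 => ab.
    by rewrite addrC [leRHS]addrC; exact: mini.
  have [p [q [c [tch pM]]]] :=
    touching_of_min f1 f0 G1 G0 (sg x0) x0 (1 - t) rf1 rf0 U1 cl0 t01' mini'.
  by exists p, (- q), (q + c); split; [exact: touchingC | rewrite sgE | right | exact: pM].
have := gmin x; rewrite inE => /(_ Kx); rewrite /g sgx.
rewrite (datum_bdry _ _ _ _ _ _ _ _ rf0 x0 cl0 nU0) (datum_bdry _ _ _ _ _ _ _ _ rf1 _ cl1 nU1).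
have := neg _ _ rf0; have := neg _ _ rf1 => n1 n0'.
have : (1 - t) * f0 x < 0 by rewrite pmulr_rlt0.
have : t * f1 x < 0 by rewrite pmulr_rlt0.
lra.
Qed.

End Touching.

Section DotLinear.
Context {R : realType} {n : nat} (p : 'rV[R]_n).

Lemma dot_is_linear : linear (dot p : 'rV[R]_n -> R).
Proof. by move=> k x y; rewrite dotDr dotZr. Qed.

HB.instance Definition _ :=
  GRing.isLinear.Build R 'rV[R]_n R _ (dot p) dot_is_linear.

End DotLinear.

(** * From support estimates to Hoelder continuity of the gradient *)

Section GradientHoelder.
Context {R : realType} {n : nat} {w : R -> R}.
Hypothesis mw : modulus w.
Implicit Types (x y z v p : 'rV[R]_n) (f : 'rV[R]_n -> R) (E Q : set 'rV[R]_n).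

Lemma differentiable_sandwich f z p (C e : R) : 0 < e ->
  (forall h, `|h| <= e -> 0 <= f (h + z) - f z - dot p h <= C * Phi w `|h|) ->
  differentiable f z /\ grad f z = p.
Proof.
move=> e0 sw.
have lo : f \o shift z = cst (f z) + dot p +o_ (0 : 'rV[R]_n) id.
  apply/eqaddoP => d d0.
  have C10 : 0 < `|C| + 1 by rewrite ltr_wpDl.
  have [r r0 wr] := modulus_small _ mw (d / (`|C| + 1)) (divr_gt0 d0 C10).
  have er0 : 0 < Num.min e r by rewrite lt_min e0.
  apply/nbhs_ballP; exists (Num.min e r) => // h.
  rewrite -ball_normE /= sub0r normrN lt_min => /andP[he hr].
  have /andP[lw up] := sw h (ltW he).
  have -> : (f \o shift z - (cst (f z) + dot p)) h = f (h + z) - f z - dot p h.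
    by rewrite /= opprD addrA.
  rewrite ger0_norm //; apply: le_trans up _; rewrite /Phi mulrCA mulrC.
  apply: ler_wpM2r => //; apply: (@le_trans _ _ (`|C| * w `|h|)).
    by apply: ler_wpM2r; [exact: (modulus_ge0 _ mw) | exact: ler_norm].
  have wh : w `|h| <= w r by apply: (modulus_mono _ mw) => //; exact: ltW.
  have w0 := modulus_ge0 _ mw `|h| (normr_ge0 _).
  apply: (@le_trans _ _ ((`|C| + 1) * w r)); last first.
    by rewrite mulrC -ler_pdivlMr // ltW.
  by apply: ler_pM => //; rewrite lerDl.
have cdot : continuous (dot p : 'rV[R]_n -> R) := continuous_dot p.
have dE := diff_unique cdot lo.
have df : differentiable f z by apply/diff_locallyP; rewrite dE.
split=> //; apply/rowP => i; rewrite mxE deriveE //.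
have dEi : 'd f z (delta_mx 0 i) = dot p (delta_mx 0 i) by rewrite dE.
by rewrite dEi dot_delta.
Qed.

(** Points of [E] may be arbitrarily close to the boundary of [Q], so not all directions can be
    tested around them. Directions towards a fixed inner ball always stay in [Q], and the vectors
    [v] of that ball still detect every component of [g z' - g z]. *)
Lemma grad_hoelder_sandwich Q E f (g : 'rV[R]_n -> 'rV[R]_n) o (r D M C e : R) :
  0 < r -> 0 < e -> 0 <= C -> convex_set Q ->
  (forall v, `|v| < r -> Q (o + v)) ->
  (forall x y, Q x -> Q y -> `|x - y| <= D) ->
  E `<=` Q -> (forall z, E z -> `|g z| <= M) ->
  (forall z y, E z -> Q y -> f z + dot (g z) (y - z) <= f y) ->
  (forall z y, E z -> Q y -> `|y - z| <= e ->
    f y <= f z + dot (g z) (y - z) + C * Phi w `|y - z|) ->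
  exists K : R, forall z z', E z -> E z' -> `|g z - g z'| <= K * w `|z - z'|.
Proof.
move=> r0 e0 C0 /convex_setE cQ ball diam EQ gM low up.
have Qo : Q o by rewrite -(addr0 o); apply: ball; rewrite normr0.
have D0 : 0 <= D by apply: le_trans (diam o o Qo Qo).
pose N : R := n%:R.
have N0 : 0 <= N by exact: ler0n.
have S0 : 0 < D + 1 by exact: ltr_wpDl.
have N10 : 0 < 2 * (N + 1) by rewrite mulr_gt0 // ltr_wpDl.
(* The three bounds make the segment parameter [s] at most 1, keep the test point within [e] of [z],
   and allow the term [N * k * |d|] to be absorbed into [r * |d|]. *)
pose r1 := Num.min 1 (Num.min (e / 2) (r / (2 * (N + 1)))).
have r10 : 0 < r1 by rewrite !lt_min ltr01 !divr_gt0.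
have wr1 := modulus_gt0 _ mw _ r10.
(* Testing both support inequalities at a point y of the segment from z' to
   o + v, at distance about |z - z'| from z and z'. *)
have test z z' v : E z -> E z' -> `|v| < r -> 0 < `|z - z'| -> `|z - z'| <= r1 ->
    dot (g z' - g z) (o + v - z') <= 4 * C * (D + 1) * w `|z - z'|.
  move=> Ez Ez' vr; set k := `|z - z'| => k0.
  rewrite !le_min => /and3P[k1 ke _].
  pose s := k / (D + 1).
  have s0 : 0 < s by rewrite divr_gt0.
  have s1 : s <= 1 by rewrite ler_pdivrMr // mul1r; move: k1 D0; clear - mw; lra.
  have s01 : 0 <= s <= 1 by rewrite ltW.
  have Qy := cQ s z' (o + v) (EQ _ Ez') (ball v vr) s01.
  have yz' : seg s z' (o + v) - z' = s *: (o + v - z').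
    by rewrite /seg; apply/rowP => i; rewrite !mxE; ring.
  have nyz' : `|seg s z' (o + v) - z'| <= k.
    rewrite yz' normrZ gtr0_norm //; apply: (@le_trans _ _ (s * (D + 1))).
      rewrite ler_pM2l //; apply: le_trans (diam _ _ (ball v vr) (EQ _ Ez')) _.
      by rewrite lerDl.
    by rewrite /s divfK // gt_eqF.
  have nyz : `|seg s z' (o + v) - z| <= 2 * k.
    have := norm_sub_trans (seg s z' (o + v)) z' z.
    rewrite (distrC z') -/k; move: nyz'; clear - mw; lra.
  have nye : `|seg s z' (o + v) - z| <= e by move: nyz ke; clear - mw; lra.
  have h1 := low z' _ Ez' Qy; have h2 := up z _ Ez Qy nye.
  have h3 := low z z' Ez (EQ _ Ez').
  have h4 : C * Phi w `|seg s z' (o + v) - z| <= C * (2 * 2 * Phi w k).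
    by apply: ler_wpM2l => //; apply: (Phi_le mw) => //; [rewrite ler1n | exact: ltW].
  have h5 : dot (g z' - g z) (s *: (o + v - z')) <= C * (2 * 2 * Phi w k).
    rewrite -yz' dotBl; move: h1 h2 h3 h4; rewrite !dotBr; clear - mw; lra.
  rewrite dotZr in h5; rewrite -(ler_pM2l s0); apply: le_trans h5 _.
  rewrite le_eqVlt; apply/orP; left; apply/eqP.
  by rewrite /Phi /s; field; rewrite gt_eqF.
exists (16 * C * (D + 1) / r + 2 * `|M| / w r1) => z z' Ez Ez'.
have M0 : 0 <= M by apply: le_trans (gM z Ez).
have A0 : 0 <= 16 * C * (D + 1) / r.
  by rewrite divr_ge0 ?mulr_ge0 // ltW.
have B0 : 0 <= 2 * `|M| / w r1 by rewrite divr_ge0 ?mulr_ge0 // ltW.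
set k := `|z - z'|; have k0 : 0 <= k by exact: normr_ge0.
have wk := modulus_ge0 _ mw k k0.
have [kr|kr] := lerP k r1; last first.
  apply: (@le_trans _ _ (2 * `|M| / w r1 * w k)); last first.
    by apply: ler_wpM2r => //; rewrite lerDr.
  apply: le_trans (norm_sub_le _ _) _; apply: (@le_trans _ _ (2 * `|M| / w r1 * w r1)).
    rewrite divfK ?gt_eqF // ger0_norm //.
    by have := gM z Ez; have := gM z' Ez'; clear - mw; lra.
  by apply: ler_wpM2l => //; apply: (modulus_mono _ mw); exact: ltW.
have [->|kn0] := eqVneq z z'.
  by rewrite subrr normr0 mulr_ge0 // addr_ge0.
have kp : 0 < k by rewrite normr_gt0 subr_eq0.
apply: (@le_trans _ _ (16 * C * (D + 1) / r * w k)); last first.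
  by apply: ler_wpM2r => //; rewrite lerDl.
pose A := 4 * C * (D + 1) * w k.
pose d := g z' - g z.
have rN : N * k * 2 <= r.
  have : k <= r / (2 * (N + 1)) by apply: le_trans kr _; rewrite !ge_min lexx !orbT.
  by rewrite ler_pdivlMr //; have := kp; clear - mw; lra.
have comp i : r * `|d 0 i| <= 2 * A + N * k * `|d|.
  have nv (c : R) : `|c| = r / 2 -> `|c *: delta_mx 0 i : 'rV[R]_n| < r.
    move=> cr; rewrite normrZ cr; apply: (@le_lt_trans _ _ (r / 2 * 1)).
      by apply: ler_wpM2l; [rewrite divr_ge0 // ltW | exact: norm_delta_le].
    by rewrite mulr1 ltr_pdivrMr //; move: r0; clear - mw; lra.
  (* Adding the test with [v] to the one with [z], [z'] exchanged and [- v] cancels [o]: what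
     remains is [2 * dot d v] and the error [dot d (z - z')]. *)
  have side (c : R) : `|c| = r / 2 -> 2 * (c * d 0 i) <= 2 * A + N * k * `|d|.
    move=> cr.
    have t1 := test z z' _ Ez Ez' (nv c cr) kp kr.
    have cr' : `|- c| = r / 2 by rewrite normrN.
    have t2 := test z' z (- c *: delta_mx 0 i) Ez' Ez (nv _ cr').
    rewrite distrC in t2; have {t2} := t2 kp kr; rewrite -/k.
    have -> : g z - g z' = - d by rewrite opprB.
    move: t1; rewrite -/d -/A dotNl !dotBr !dotDr !dotZr !dot_delta.
    have := norm_dot_le d (z - z').
    rewrite dotBr ler_norml -/k -/N; clear - mw; lra.
  have r20 : 0 <= r / 2 by rewrite divr_ge0 // ltW.
  have := side (r / 2) (ger0_norm r20).
  have := side (- (r / 2)); rewrite normrN (ger0_norm r20) => /(_ erefl).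
  have -> : r * `|d 0 i| = `|r * d 0 i| by rewrite normrM gtr0_norm.
  rewrite ler_norml; clear - mw; lra.
have : r * `|d| <= 2 * A + N * k * `|d|.
  rewrite mulrC -ler_pdivlMr //; apply: norm_row_le => [|i]; last first.
    by rewrite ler_pdivlMr // mulrC.
  apply: divr_ge0; last exact: ltW.
  by rewrite addr_ge0 // /A ?mulr_ge0 // ltW.
have -> : 16 * C * (D + 1) / r * w k = 16 * C * (D + 1) * w k / r by ring.
rewrite ler_pdivlMr // => final; rewrite (_ : `|g z - g z'| = `|d|); last exact: distrC.
move: final; rewrite /A.
have : N * k * 2 * `|d| <= r * `|d| by exact: ler_wpM2r.
clear - mw; lra.
Qed.

End GradientHoelder.

(** * Space-time coordinates and the cylinder *)

Section Cylinder.
Context {R : realType} {n : nat}.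
Implicit Types (x y p : 'rV[R]_n) (t s q : R) (z : 'rV[R]_(n + 1)) (U : set 'rV[R]_n).

Lemma xt_left x t : lsubmx (xt x t) = x.
Proof. exact: row_mxKl. Qed.

Lemma xt_right x t : rsubmx (xt x t) 0 0 = t.
Proof. by rewrite row_mxKr mxE. Qed.

Lemma xt_eta z : z = xt (lsubmx z) (rsubmx z 0 0).
Proof.
rewrite -[LHS]hsubmxK; congr row_mx.
by apply/matrixP => i j; rewrite (ord1 i) (ord1 j) [RHS]mxE.
Qed.

Lemma dot_xt p q x t : dot (xt p q) (xt x t) = dot p x + q * t.
Proof.
rewrite /dot big_split_ord /= big_ord1; congr (_ + _).
  by apply: eq_bigr => i _; rewrite !row_mxEl.
by rewrite !row_mxEr !mxE.
Qed.

Lemma seg_xt (e : R) x t y s :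
  seg e (xt x t) (xt y s) = xt (seg e x y) ((1 - e) * t + e * s).
Proof.
rewrite /seg /xt !scale_row_mx add_row_mx; congr row_mx.
by apply/matrixP => i j; rewrite !mxE.
Qed.

Lemma sub_xt x t y s : xt x t - xt y s = xt (x - y) (t - s).
Proof.
rewrite /xt opp_row_mx add_row_mx; congr row_mx.
by apply/matrixP => i j; rewrite !mxE.
Qed.

Lemma norm_xt_left x t : `|x| <= `|xt x t|.
Proof.
apply: norm_row_le => [|i]; first exact: normr_ge0.
by have := coord_le_norm (xt x t) (lshift 1 i); rewrite row_mxEl.
Qed.

Lemma norm_xt_right x t : `|t| <= `|xt x t|.
Proof.
by have := coord_le_norm (xt x t) (rshift n ord0); rewrite row_mxEr mxE.
Qed.

Lemma norm_xt_le x t (c : R) : `|x| <= c -> `|t| <= c -> `|xt x t| <= c.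
Proof.
move=> xc tc; apply: norm_row_le => [|i]; first exact: le_trans tc.
case: (split_ordP i) => j ->; last by rewrite row_mxEr mxE.
by rewrite row_mxEl; apply: le_trans xc; exact: coord_le_norm.
Qed.

Lemma unit_cyl_xt U x t : unit_cyl U (xt x t) <-> U x /\ 0 < t < 1.
Proof. by rewrite /unit_cyl /cyl /= xt_left xt_right in_itv. Qed.

Lemma bounded_unit_cyl U : bounded_set U -> bounded_set (unit_cyl U).
Proof.
move=> [N [_ HN]]; exists (`|N| + 1); split; first exact: num_real.
move=> N' NN' z; rewrite (xt_eta z) => /unit_cyl_xt[Ux t01] /=.
apply: norm_xt_le.
  by apply: (HN N') => //; apply: le_lt_trans (ler_norm N) _; apply: le_lt_trans NN'; rewrite lerDl.
apply: ltW; apply: le_lt_trans NN'; rewrite ger0_norm; last by case/andP: t01 => /ltW.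
by have := normr_ge0 N; case/andP: t01 => _ /ltW; lra.
Qed.

Lemma open_unit_cyl U : open U -> open (unit_cyl U).
Proof.
move=> oU; rewrite openE => z; rewrite (xt_eta z) => /unit_cyl_xt[].
move: (lsubmx z) (rsubmx z 0 0) => x t Ux /andP[t0 t1].
have /nbhs_ballP[d /= d0 dB] := open_nbhs_nbhs (conj oU Ux).
apply/nbhs_ballP; exists (Num.min d (Num.min t (1 - t))) => /=.
  by rewrite !lt_min d0 t0 subr_gt0.
move=> z'; rewrite (xt_eta z') -ball_normE /= sub_xt !lt_min => /and3P[zd zt zt'].
apply/unit_cyl_xt; split.
  by apply: dB; rewrite -ball_normE /=; apply: le_lt_trans zd; exact: norm_xt_left.
have := norm_xt_right (x - lsubmx z') (t - rsubmx z' 0 0).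
move=> h; have := le_lt_trans h zt; have := le_lt_trans h zt'.
by rewrite !ltr_norml; lra.
Qed.

Lemma closure_unit_cyl_sub U x t : closure (unit_cyl U) (xt x t) ->
  closure U x /\ 0 <= t <= 1.
Proof.
move=> clz; split.
  move=> B /nbhs_ballP[d /= d0 dB].
  have [z [Qz zB]] := clz _ (nbhsx_ballx (xt x t) d d0).
  rewrite (xt_eta z) in Qz zB; have [Uz _] := (unit_cyl_xt _ _ _).1 Qz.
  exists (lsubmx z); split=> //; apply: dB; move: zB; rewrite -!ball_normE /= sub_xt.
  by apply: le_lt_trans; exact: norm_xt_left.
have near d : 0 < d -> exists2 s, 0 < s < 1 & `|t - s| < d.
  move=> d0; have [z [Qz zB]] := clz _ (nbhsx_ballx (xt x t) d d0).
  rewrite (xt_eta z) in Qz zB; have [_ z01] := (unit_cyl_xt _ _ _).1 Qz.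
  exists (rsubmx z 0 0) => //; move: zB; rewrite -!ball_normE /= sub_xt.
  by apply: le_lt_trans; exact: norm_xt_right.
apply/andP; split; rewrite leNgt; apply/negP => t0.
  have [|s s01] := near (- t); first by rewrite oppr_gt0.
  by rewrite ltr_norml; move: s01; lra.
have [|s s01] := near (t - 1); first by rewrite subr_gt0.
by rewrite ltr_norml; move: s01; lra.
Qed.

End Cylinder.

(** * Traces of the solution, and its bounds by chords and planes *)

Section Solution.
Context {R : realType} {n : nat} {U : set 'rV[R]_n} {alpha : R}
  {u0 u1 : 'rV[R]_n -> R} {u : 'rV[R]_(n + 1) -> R}.
Implicit Types (x y p : 'rV[R]_n) (t s q c : R) (z : 'rV[R]_(n + 1)).
Hypothesis n0 : (0 < n)%N.
Hypothesis scd : strictly_convex_domain U.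
Hypothesis bU : bounded_set U.
Hypothesis a01 : 0 < alpha <= 1.
Hypothesis S0 : S_tilde alpha U u0.
Hypothesis S1 : S_tilde alpha U u1.
Hypothesis sol : dirichlet_solution U u0 u1 u.

Let Q := unit_cyl U.
Let oU : open U. Proof. by case: scd. Qed.

(** The cylinder is not strictly convex, but segments towards an interior point at time 1/2 enter it
    at once; this is the star-shape needed to extend inequalities to its closure. *)
Lemma unit_cyl_star x0 z s : U x0 -> closure Q z -> 0 < s <= 1 ->
  Q (seg s z (xt x0 (1 / 2))).
Proof.
move=> Ux0; rewrite (xt_eta z) => /closure_unit_cyl_sub[clx t01] s01.
rewrite seg_xt; apply/unit_cyl_xt; split; first exact: (scd_star scd).
move: (rsubmx z 0 0) t01 => t /andP[t0 t1]; case/andP: s01 => s0 s1.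
have h0 : 0 <= (1 - s) * t by rewrite mulr_ge0 // subr_ge0.
have h1 : (1 - s) * t <= (1 - s) * 1 by rewrite ler_wpM2l // subr_ge0.
by move: s0 s1 h0 h1; lra.
Qed.

Lemma closure_unit_cyl x t : closure U x -> 0 <= t <= 1 -> closure Q (xt x t).
Proof.
move=> clx /andP[t0 t1]; have [[ctr Uc] _ _ _] := scd.
apply: (closure_seg _ _ (xt ctr (1 / 2))) => s /andP[s0 s1].
rewrite seg_xt; apply/unit_cyl_xt; split; first by apply: (scd_star scd); rewrite ?s0.
have h0 : 0 <= (1 - s) * t by rewrite mulr_ge0 // subr_ge0.
have h1 : (1 - s) * t <= (1 - s) * 1 by rewrite ler_wpM2l // subr_ge0.
by move: s0 s1 h0 h1; lra.
Qed.

Lemma convex_unit_cyl : convex_set Q.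
Proof.
have [_ _ /convex_setE cU _] := scd.
apply/convex_setE => s z z'; rewrite (xt_eta z) (xt_eta z').
move=> /unit_cyl_xt[Ux t01] /unit_cyl_xt[Uy t'01] s01.
rewrite seg_xt; apply/unit_cyl_xt; split; first exact: cU.
move: (rsubmx z 0 0) (rsubmx z' 0 0) t01 t'01 => t t' /andP[t0 t1] /andP[t'0 t'1].
case/andP: s01 => s0 s1.
have [->|sn0] := eqVneq s 0; first by rewrite subr0 mul1r mul0r addr0 t0.
have sp : 0 < s by rewrite lt_neqAle eq_sym sn0.
have h0 : 0 <= (1 - s) * t by rewrite mulr_ge0 ?subr_ge0 // ltW.
have h1 : (1 - s) * t <= (1 - s) * 1 by rewrite ler_wpM2l ?subr_ge0 // ltW.
have h2 : 0 < s * t' by rewrite mulr_gt0.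
have h3 : s * t' < s * 1 by rewrite ltr_pM2l.
by move: h0 h1 h2 h3; lra.
Qed.

(** The boundary condition covers only [0 < t < 1]; the corners are reached by continuity along the
    vertical segment towards time 1/2. *)
Lemma trace_bdry x t : closure U x -> ~ U x -> 0 <= t <= 1 -> u (xt x t) = 0.
Proof.
move=> clx nUx t01; have [cu _ _ _ ub] := sol.
have bx : bdry U x by apply/(bdry_openE _ _ oU).
have cl0 := closure_unit_cyl x t clx t01.
have clh s : 0 < s <= 1 -> 0 < (1 - s) * t + s * (1 / 2) < 1.
  move=> /andP[s0 s1]; case/andP: t01 => t0 t1.
  have h0 : 0 <= (1 - s) * t by rewrite mulr_ge0 // subr_ge0.
  have h1 : (1 - s) * t <= (1 - s) * 1 by rewrite ler_wpM2l // subr_ge0.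
  by move: s0 s1 h0 h1; lra.
have lim : u (seg s (xt x t) (xt x (1 / 2))) @[s --> (0 : R)^'+] --> u (xt x t).
  apply: (seg_cvg_within (closure Q)) => // s s01.
  rewrite seg_xt segxx; apply: closure_unit_cyl => //.
  by have := clh s s01; lra.
have zero s : 0 < s <= 1 -> u (seg s (xt x t) (xt x (1 / 2))) = 0.
  by move=> s01; rewrite seg_xt segxx ub // clh.
apply/eqP; rewrite eq_le; apply/andP; split.
  apply: (ler_cvg_to lim (cvg_cst (0 : R))).
  by apply: near_at_right01 => s s01; rewrite zero.
apply: (ler_cvg_to (cvg_cst (0 : R)) lim).
by apply: near_at_right01 => s s01; rewrite zero.
Qed.

Lemma trace0 x : closure U x -> u (xt x 0) = u0 x.
Proof.
move=> clx; have [Ux|nUx] := pselect (U x).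
  by have [_ _ _ ub _] := sol; case: (ub x Ux).
have [_ _ _ _ b0] := S0.
rewrite trace_bdry ?lexx ?ler01 // b0 //; exact/(bdry_openE _ _ oU).
Qed.

Lemma trace1 x : closure U x -> u (xt x 1) = u1 x.
Proof.
move=> clx; have [Ux|nUx] := pselect (U x).
  by have [_ _ _ ub _] := sol; case: (ub x Ux).
have [_ _ _ _ b1] := S1.
rewrite trace_bdry ?lexx ?ler01 // b1 //; exact/(bdry_openE _ _ oU).
Qed.

Lemma chord_le a b s : closure U a -> closure U b -> 0 <= s <= 1 ->
  u (xt (seg s a b) s) <= (1 - s) * u0 a + s * u1 b.
Proof.
move=> cla clb s01; have [cu cvu _ _ _] := sol; have [[ctr Uc] _ _ _] := scd.
have := convex_function_closure (fun z e => unit_cyl_star ctr z e Uc) u s (xt a 0) (xt b 1)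
  convex_unit_cyl cvu cu (closure_unit_cyl a 0 cla _) (closure_unit_cyl b 1 clb _) s01.
rewrite seg_xt mulr0 mulr1 add0r trace0 // trace1 //.
by apply; rewrite ?lexx ?ler01.
Qed.

(** By the maximum principle it suffices to compare on the boundary of the cylinder. Top and bottom
    are the hypotheses; on the lateral side the plane interpolates its values at times 0 and 1, both
    at most 0 there. *)
Lemma plane_le p q c :
  (forall y, closure U y -> dot p y + c <= u0 y) ->
  (forall y, closure U y -> dot p y + q + c <= u1 y) ->
  forall y s, U y -> 0 < s < 1 -> dot p y + q * s + c <= u (xt y s).
Proof.
move=> le0 le1 y s Uy s01; have [cu cvu ma _ _] := sol.
have oQ : open Q by exact: open_unit_cyl.
rewrite -dot_xt; apply: (affine_le_of_alexandrov Q) => //.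
- exact: bounded_unit_cyl.
- move=> z /(bdry_openE _ _ oQ); rewrite (xt_eta z).
  move: (lsubmx z) (rsubmx z 0 0) => x t [/closure_unit_cyl_sub[clx t01] nQ].
  rewrite dot_xt; have [t0|tn0] := eqVneq t 0.
    by rewrite t0 trace0 // mulr0 addr0; exact: le0.
  have [t1|tn1] := eqVneq t 1.
    by rewrite t1 trace1 // mulr1; exact: le1.
  have t01' : 0 < t < 1 by rewrite !lt_neqAle eq_sym tn0 tn1.
  have nUx : ~ U x by move=> Ux; apply: nQ; apply/unit_cyl_xt.
  rewrite trace_bdry //; have /andP[t0 t1] := t01.
  have [_ _ _ _ b0] := S0; have [_ _ _ _ b1] := S1.
  have bx : bdry U x by apply/(bdry_openE _ _ oU).
  have := le0 x clx; have := le1 x clx; rewrite b0 // b1 // => l1 l0.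
  have t1' : 0 <= 1 - t by rewrite subr_ge0.
  by have := ler_wpM2l t1' l0; have := ler_wpM2l t0 l1; rewrite !mulr0; lra.
- exact/unit_cyl_xt.
Qed.

End Solution.

(** The two alternatives are those of [region_estimate], so that its constants are uniform on this
    set. *)
Definition away_from_corners {R : realType} {n : nat} (U : set 'rV[R]_n) (eta : R) :
    set 'rV[R]_(n + 1) :=
  [set z | unit_cyl U z /\ (eta <= rsubmx z 0 0 <= 1 - eta \/
     forall v, `|v| < eta -> U (lsubmx z + v))].

(** * Regularity of the solution away from the corners *)

Section Regularity.
Context {R : realType} {n : nat} {U : set 'rV[R]_n} {alpha : R}
  {u0 u1 : 'rV[R]_n -> R} {u : 'rV[R]_(n + 1) -> R}.
Implicit Types (x y p : 'rV[R]_n) (t s q c eta : R) (z : 'rV[R]_(n + 1)).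
Hypothesis n0 : (0 < n)%N.
Hypothesis scd : strictly_convex_domain U.
Hypothesis bU : bounded_set U.
Hypothesis a01 : 0 < alpha <= 1.
Hypothesis S0 : S_tilde alpha U u0.
Hypothesis S1 : S_tilde alpha U u1.
Hypothesis sol : dirichlet_solution U u0 u1 u.

Let Q := unit_cyl U.
Let w (r : R) := r `^ alpha.
Let mw : modulus w. Proof. exact: powR_modulus. Qed.
Let oU : open U. Proof. by case: scd. Qed.

Lemma support_estimate eta : 0 < eta ->
  exists C e M B : R, [/\ 0 <= C, 0 < e &
    forall z, away_from_corners U eta z -> exists P : 'rV[R]_(n + 1),
      [/\ `|P| <= M, `|u z| <= B,
        forall z', Q z' -> u z + dot P (z' - z) <= u z' &
        forall z', Q z' -> `|z' - z| <= e ->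
          u z' <= u z + dot P (z' - z) + C * Phi w `|z' - z|]].
Proof.
move=> eta0.
have [ctr [r0 [D dU]]] := scd_ray_domain scd bU n0.
have Uc : U ctr.
  rewrite -(addr0 ctr); apply: (ray_ball _ _ _ _ dU); rewrite normr0.
  by case/andP: (ray_r0 _ _ _ _ dU).
have [H [M [m [B0 [rf0' B0P]]]]] := S_tilde_regular_datum alpha u0 ctr n0 scd bU a01 Uc S0.
have [H' [M' [m' [B1 [rf1' B1P]]]]] := S_tilde_regular_datum alpha u1 ctr n0 scd bU a01 Uc S1.
have [_ _ m0] := datum_const _ _ _ _ _ _ _ _ rf0'.
have [_ _ m'0] := datum_const _ _ _ _ _ _ _ _ rf1'.
have mm0 : 0 < Num.min m m' by rewrite lt_min m0.
have rf0 : regular_datum U ctr w u0 (grad u0) (Num.max H H') (Num.max M M') (Num.min m m').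
  by apply: (regular_datum_weaken _ _ _ _ _ _ _ _ _ _ mw _ _ _ _ rf0');
    rewrite ?le_max ?ge_min ?lexx.
have rf1 : regular_datum U ctr w u1 (grad u1) (Num.max H H') (Num.max M M') (Num.min m m').
  by apply: (regular_datum_weaken _ _ _ _ _ _ _ _ _ _ mw _ _ _ _ rf1');
    rewrite ?le_max ?ge_min ?lexx ?orbT.
clear rf0' rf1' m0 m'0 mm0.
move: (Num.max H H') (Num.max M M') (Num.min m m') rf0 rf1 => {}H {}M {}m rf0 rf1.
have [_ M0 _] := datum_const _ _ _ _ _ _ _ _ rf0.
have [C [e [C0 e0 est]]] := region_estimate oU mw dU u0 u1 _ _ eta rf0 rf1 eta0.
pose MQ := B0 + B1 + n%:R * M * D + M.
exists C, e, MQ, (B0 + B1); split=> // z; rewrite (xt_eta z).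
move: (lsubmx z) (rsubmx z 0 0) => x t [/unit_cyl_xt[Ux t01] reg].
rewrite xt_left xt_right in reg.
have cpt := bounded_closure_compact U bU.
have [_ cu0 _ _ _] := S0; have [_ cu1 _ _ _] := S1.
have [x0 [x1 [p [q [c [tch xE U01 pM]]]]]] :=
  exists_touching oU mw dU u0 u1 _ _ x t rf0 rf1 cu0 cu1 cpt Ux t01.
have [cl0 cl1 le0 le1 eq0 eq1] := tch.
have /andP[t0 t1] := t01.
have t01' : 0 <= t <= 1 by rewrite !ltW.
have t1' : 0 <= 1 - t by rewrite subr_ge0 ltW.
have below := plane_le scd bU S0 S1 sol p q c le0 le1.
have uE : u (xt x t) = dot p x + q * t + c.
  apply/eqP; rewrite eq_le below // andbT.
  have := chord_le scd S0 S1 sol x0 x1 t cl0 cl1 t01'; rewrite -xE.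
  by rewrite xE dot_seg eq0 eq1; lra.
have b0 := B0P x0 cl0; have b1 := B1P x1 cl1.
have B00 : 0 <= B0 := le_trans (normr_ge0 _) b0.
have B10 : 0 <= B1 := le_trans (normr_ge0 _) b1.
have D0 : 0 <= D := le_trans ler01 (ray_D _ _ _ _ dU).
have nMD : 0 <= n%:R * M * D by rewrite !mulr_ge0.
exists (xt p q); split.
- apply: norm_xt_le; first by apply: le_trans pM _; rewrite lerDr !addr_ge0.
  (* The contact equalities bound the time slope by the values of the data and by [p]. *)
  have qE : q = u1 x1 - u0 x0 + dot p (x0 - x1) by rewrite dotBr eq0 eq1; ring.
  have dd : `|dot p (x0 - x1)| <= n%:R * M * D.
    apply: le_trans (norm_dot_le _ _) _; apply: ler_pM; rewrite ?mulr_ge0 //.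
      by rewrite ler_wpM2l.
    exact: (ray_diam _ _ _ _ dU).
  move: b0 b1 dd M0; rewrite /MQ ler_norml qE !ler_norml; clear - n0 scd bU a01 S0 S1 sol mw oU Q; lra.
- have -> : u (xt x t) = (1 - t) * u0 x0 + t * u1 x1.
    by rewrite uE xE dot_seg eq0 eq1; ring.
  apply: le_trans (ler_normD _ _) _; rewrite !normrM (ger0_norm t1') (ger0_norm (ltW t0)).
  apply: lerD; [apply: le_trans _ b0 | apply: le_trans _ b1]; apply: ler_piMl => //.
    by rewrite gerBl ltW.
  exact: ltW.
- move=> z'; rewrite (xt_eta z') => /unit_cyl_xt[Uy s01].
  by rewrite sub_xt dot_xt uE dotBr; have := below _ _ Uy s01; clear - n0 scd bU a01 S0 S1 sol mw oU Q; lra.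
- move=> z'; rewrite (xt_eta z') => /unit_cyl_xt[Uy s01].
  move: (lsubmx z') (rsubmx z' 0 0) Uy s01 => y s Uy s01.
  rewrite sub_xt => he; set h := `|xt (y - x) (s - t)| in he *.
  have yh : `|y - seg t x0 x1| <= h by rewrite -xE; exact: norm_xt_left.
  have sth : `|s - t| <= h by exact: norm_xt_right.
  rewrite xE in reg.
  have [a [b [cla clb yE up]]] :=
    est x0 x1 p q c t s y h tch U01 reg t01 s01 Uy yh sth he.
  have s01' : 0 <= s <= 1 by case/andP: s01 => s0 s1; rewrite !ltW.
  have := chord_le scd S0 S1 sol a b s cla clb s01'; rewrite -yE.
  by rewrite dot_xt uE dotBr; move: up; clear - n0 scd bU a01 S0 S1 sol mw oU Q; lra.
Qed.

Lemma gradient_estimate eta : 0 < eta ->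
  exists C e M B : R, [/\ 0 <= C, 0 < e &
    forall z, away_from_corners U eta z ->
      [/\ differentiable u z, `|grad u z| <= M, `|u z| <= B,
        forall z', Q z' -> u z + dot (grad u z) (z' - z) <= u z' &
        forall z', Q z' -> `|z' - z| <= e ->
          u z' <= u z + dot (grad u z) (z' - z) + C * Phi w `|z' - z|]].
Proof.
move=> eta0; have [C [e [M [B [C0 e0 est]]]]] := support_estimate eta eta0.
exists C, e, M, B; split=> // z az; have [P [PM uB low up]] := est z az.
have [Qz _] := az; have oQ : open Q by exact: open_unit_cyl.
have /nbhs_ballP[d /= d0 dB] := open_nbhs_nbhs (conj oQ Qz).
have de0 : 0 < Num.min (d / 2) e by rewrite lt_min divr_gt0.
have [|du gu] := differentiable_sandwich mw u z P C (Num.min (d / 2) e) de0.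
  move=> h; rewrite le_min => /andP[hd he].
  have Qh : Q (h + z).
    apply: dB; rewrite -ball_normE /= opprD addrCA subrr addr0 normrN.
    by apply: le_lt_trans hd _; rewrite ltr_pdivrMr //; move: d0; clear - n0 scd bU a01 S0 S1 sol mw oU Q; lra.
  have := low _ Qh; have := up _ Qh; rewrite addrK => /(_ he).
  by clear - n0 scd bU a01 S0 S1 sol mw oU Q; lra.
by rewrite gu.
Qed.

Lemma gradient_hoelder eta : 0 < eta ->
  exists K : R, forall z z', away_from_corners U eta z -> away_from_corners U eta z' ->
    `|grad u z - grad u z'| <= K * `|z - z'| `^ alpha.
Proof.
move=> eta0; have [C [e [M [B [C0 e0 est]]]]] := gradient_estimate eta eta0.
have [ctr [r0 [D dU]]] := scd_ray_domain scd bU n0.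
have [D' D'0 diam] := bounded_closure_diam Q (bounded_unit_cyl U bU).
have r00 : 0 < r0 by case/andP: (ray_r0 _ _ _ _ dU).
apply: (grad_hoelder_sandwich mw Q (away_from_corners U eta) u (grad u)
  (xt ctr (1 / 2)) (Num.min r0 (1 / 2)) D' M C e) => //.
- by rewrite lt_min r00 divr_gt0.
- exact: convex_unit_cyl.
- move=> v; rewrite (xt_eta v) lt_min => /andP[vr v2].
  have -> : xt ctr (1 / 2) + xt (lsubmx v) (rsubmx v 0 0) =
      xt (ctr + lsubmx v) (1 / 2 + rsubmx v 0 0).
    rewrite /xt add_row_mx; congr row_mx.
    by apply/matrixP => i j; rewrite !mxE.
  apply/unit_cyl_xt; split.
    apply: (ray_ball _ _ _ _ dU); apply: le_lt_trans vr; exact: norm_xt_left.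
  have := le_lt_trans (norm_xt_right _ _) v2; rewrite ltr_norml; clear - n0 scd bU a01 S0 S1 sol mw oU Q; lra.
- by move=> x y Qx Qy; apply: diam; exact: subset_closure.
- by move=> z [].
- by move=> z /est[].
- by move=> z y /est[_ _ _ low _]; exact: low.
- by move=> z y /est[_ _ _ _ up]; exact: up.
Qed.

Lemma C1a_norm_away (E : set 'rV[R]_(n + 1)) eta : 0 < eta ->
  E `<=` away_from_corners U eta -> (C1a_norm alpha u E < +oo)%E.
Proof.
move=> eta0 Eaway; have [C [e [M [B [C0 e0 est]]]]] := gradient_estimate eta eta0.
have [K hK] := gradient_hoelder eta eta0.
apply: (C1a_norm_lt_pinfty alpha B M K).
- by move=> z /Eaway/est[].
- by move=> z /Eaway/est[].
- by move=> z z' /Eaway Ez /Eaway Ez'; exact: hK.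
Qed.

Lemma C1_on_unit_cyl : C1_on Q u.
Proof.
move=> z; rewrite (xt_eta z); move: (lsubmx z) (rsubmx z 0 0) => x t Qz.
have [Ux /andP[t0 t1]] := (unit_cyl_xt _ _ _).1 Qz.
(* The factor 1/2 leaves a margin: all points of the cylinder within [eta] of [(x, t)] satisfy the
   time alternative with the same [eta]. *)
pose eta := Num.min t (1 - t) / 2.
have eta0 : 0 < eta by rewrite divr_gt0 // lt_min t0 subr_gt0.
have etat : eta * 2 <= t by rewrite divfK // ge_min lexx.
have etat' : eta * 2 <= 1 - t by rewrite divfK // ge_min lexx orbT.
have near z' : Q z' -> `|xt x t - z'| < eta -> away_from_corners U eta z'.
  move=> Qz' zz'; split=> //; left; move: zz'.
  rewrite (xt_eta z') sub_xt xt_right => zz'.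
  have := le_lt_trans (norm_xt_right _ _) zz'; rewrite ltr_norml.
  by move: etat etat' eta0; clear - n0 scd bU a01 S0 S1 sol mw oU Q; lra.
have az : away_from_corners U eta (xt x t) by apply: near => //; rewrite subrr normr0.
have [C [e [M [B [C0 e0 est]]]]] := gradient_estimate eta eta0.
have [K hK] := gradient_hoelder eta eta0.
have [du _ _ _ _] := est _ az; split=> //.
have oQ : open Q by exact: open_unit_cyl.
have /nbhs_ballP[d /= d0 dB] := open_nbhs_nbhs (conj oQ Qz).
move=> B' /nbhs_ballP[k /= k0 kB].
have K10 : 0 < `|K| + 1 by rewrite ltr_wpDl.
have [r r0 wr] := modulus_small _ mw (k / (`|K| + 1)) (divr_gt0 k0 K10).
apply/nbhs_ballP; exists (Num.min r (Num.min d eta)) => /=.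
  by rewrite !lt_min r0 d0.
move=> z'; rewrite -ball_normE /= !lt_min => /and3P[zr zd zeta].
have Qz' : Q z' by apply: dB; rewrite -ball_normE.
apply: kB; rewrite -ball_normE /=.
apply: le_lt_trans (hK _ _ az (near _ Qz' zeta)) _.
have wle : w `|xt x t - z'| <= w r by apply: (modulus_mono _ mw) => //; exact: ltW.
have w0 := modulus_ge0 _ mw _ (normr_ge0 (xt x t - z')).
apply: (@le_lt_trans _ _ ((`|K| + 1) * w r)); last by rewrite mulrC -ltr_pdivlMr.
apply: (@le_trans _ _ (`|K| * w `|xt x t - z'|)).
  by apply: ler_wpM2r => //; exact: ler_norm.
by apply: ler_pM => //; rewrite lerDl.
Qed.

(** Compactness of the boundary makes [W] contain a corner neighbourhood of uniform size [e]. A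
    point with time near 0 or 1 and [lam * r0 < eta] is within [e / 2] of a corner; otherwise
    [ray_ball_at] provides the [eta]-ball. *)
Lemma away_of_nbhs_corners (W : set 'rV[R]_(n + 1)) :
  cyl (bdry U) [set 0; 1] `<=` interior W ->
  exists2 eta : R, 0 < eta & Q `\` W `<=` away_from_corners U eta.
Proof.
move=> cW; have [ctr [r0 [D dU]]] := scd_ray_domain scd bU n0.
have /andP[r00 r01] := ray_r0 _ _ _ _ dU.
have D1 := ray_D _ _ _ _ dU.
have cpt : compact (bdry U).
  apply: (@subclosed_compact _ _ (closure U)).
  - by apply: closedI; [exact: closed_closure | apply: open_closedC; exact: open_interior].
  - exact: bounded_closure_compact.
  - by move=> y [].
pose P (e : R) (b : 'rV[R]_n) :=
  forall z, (`|xt b 0 - z| < e \/ `|xt b 1 - z| < e) -> W z.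
have [e e0 We] : exists2 e : R, 0 < e & forall b, bdry U b -> P e b.
  have cov : \forall e \near (0 : R)^'+, bdry U `<=` P e.
    have ncov := (compact_near_coveringP _).1 cpt.
    apply: (ncov R (0 : R)^'+ P _) => b bb.
    have nb s : s = 0 \/ s = 1 -> exists2 r, 0 < r & ball (xt b s) r `<=` W.
      move=> s01; have /nbhs_ballP[r /= rp rW] : nbhs (xt b s) W.
        by apply: cW; rewrite /cyl /= xt_left xt_right.
      by exists r.
    have [ra ra0 raW] := nb 0 (or_introl erefl).
    have [rb rb0 rbW] := nb 1 (or_intror erefl).
    (* Half of the radius pays for moving from [b] to a nearby boundary point [b'], the other half
       is the size available at [b']. *)
    have r2 : 0 < Num.min ra rb / 2 by rewrite divr_gt0 // lt_min ra0.
    exists (ball b (Num.min ra rb / 2), [set e | e < Num.min ra rb / 2]).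
      split; first exact: nbhsx_ballx.
      exact: nbhs_right_lt.
    move=> [b' e] /= []; rewrite -ball_normE /= => bb' er z zz.
    have bxt s : `|xt b s - xt b' s| < Num.min ra rb / 2.
      by rewrite sub_xt subrr; apply: le_lt_trans bb'; apply: norm_xt_le; rewrite ?normr0.
    have [min1 min2] : Num.min ra rb <= ra /\ Num.min ra rb <= rb.
      by rewrite !ge_min !lexx orbT.
    case: zz => zz; [apply: raW | apply: rbW]; rewrite -ball_normE /=;
      (apply: le_lt_trans (norm_sub_trans _ (xt b' _) _) _);
      [have := bxt 0 | have := bxt 1];
      move: zz er min1 min2; clear - n0 scd bU a01 S0 S1 sol mw oU Q; lra.
  have [e [e0 We]] := @filter_ex _ _ (at_right_proper_filter (0 : R)) _
    (@filterI _ _ (at_right_proper_filter (0 : R)) _ _ (nbhs_right_gt (0 : R)) cov).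
  by exists e.
have D20 : 0 < D + 1 by move: D1; clear - n0 scd bU a01 S0 S1 sol mw oU Q; lra.
pose eta := Num.min (e / 2) (e * r0 / (2 * (D + 1))).
have eta0 : 0 < eta by rewrite lt_min !divr_gt0 ?mulr_gt0.
have etae : eta <= e / 2 by rewrite ge_min lexx.
have etaD : eta * (2 * (D + 1)) <= e * r0.
  by rewrite -ler_pdivlMr ?mulr_gt0 // ge_min lexx orbT.
exists eta => // z [Qz nWz]; split=> //.
move: Qz nWz; rewrite (xt_eta z) xt_left xt_right.
move: (lsubmx z) (rsubmx z 0 0) => x t /unit_cyl_xt[Ux t01] nW.
have [tin|tout] := boolP (eta <= t <= 1 - eta); [by left | right].
have [b [lam [clb nUb lam01 xE]]] := ray_dec _ _ _ _ dU x (subset_closure Ux).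
have lam0 : 0 < lam by apply/(ray_inside dU b lam) => //; rewrite -xE.
have bb : bdry U b by apply/(bdry_openE _ _ oU).
have lamr : eta <= lam * r0.
  rewrite leNgt; apply/negP => lr; apply: nW; apply: (We b bb).
  have bx : `|b - x| <= e / 2.
    rewrite xE; apply: le_trans (ray_dist dU b lam clb (ltW lam0)) _.
    rewrite -(ler_pM2r r00).
    have h1 : lam * r0 * D <= eta * D by apply: ler_wpM2r; [exact: le_trans D1 | exact: ltW].
    by move: h1 etaD eta0; clear - n0 scd bU a01 S0 S1 sol mw oU Q; lra.
  have e2 : e / 2 < e by rewrite ltr_pdivrMr //; move: e0; clear - n0 scd bU a01 S0 S1 sol mw oU Q; lra.
  have [tl|tr] : t < eta \/ 1 - eta < t.
    by move: tout; rewrite negb_and -!ltNge => /orP[?|?]; [left|right].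
  - left; rewrite sub_xt; apply: le_lt_trans e2; apply: norm_xt_le => //.
    by rewrite sub0r normrN gtr0_norm; move: t01 tl etae; clear - n0 scd bU a01 S0 S1 sol mw oU Q; lra.
  - right; rewrite sub_xt; apply: le_lt_trans e2; apply: norm_xt_le => //.
    by rewrite gtr0_norm; move: t01 tr etae; clear - n0 scd bU a01 S0 S1 sol mw oU Q; lra.
move=> v veta; rewrite xE; apply: (ray_ball_at dU) => //.
  by rewrite lam0; case/andP: lam01.
exact: lt_le_trans lamr.
Qed.

End Regularity.

Theorem theorem0p5 (R : realType) (n : nat) (hn : (0 < n)%N)
  (U : set 'rV[R]_n) (alpha : R) (u0 u1 : 'rV[R]_n -> R)
  (u : 'rV[R]_(n + 1) -> R) :
  strictly_convex_domain U -> smoothly_bounded U ->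
  0 < alpha <= 1 ->
  S_tilde alpha U u0 -> S_tilde alpha U u1 ->
  dirichlet_solution U u0 u1 u ->
  C1a_loc alpha (unit_cyl U) u /\
  forall W : set 'rV[R]_(n + 1),
    cyl (bdry U) [set 0; 1] `<=` interior W ->
    (C1a_norm alpha u (unit_cyl U `\` W) < +oo)%E.
Proof.
move=> scd [bU _] a01 S0 S1 sol.
have corners W : cyl (bdry U) [set 0; 1] `<=` interior W ->
    (C1a_norm alpha u (unit_cyl U `\` W) < +oo)%E.
  move=> cW; have [eta eta0 away] := away_of_nbhs_corners hn scd bU W cW.
  exact: (C1a_norm_away hn scd bU a01 S0 S1 sol _ eta eta0 away).
split=> //; split; first exact: (C1_on_unit_cyl hn scd bU a01 S0 S1 sol).
(* The local bound is an instance of the corner statement: the complement of a compact [K] in the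
   cylinder is open and contains the corners, whose times are 0 and 1. *)
move=> K cptK KQ; have := corners (~` K).
rewrite setDE setCK (setIidr KQ); apply.
have clK : closed K by apply: compact_closed => //; exact: norm_hausdorff.
have -> : interior (~` K) = ~` K by apply/interior_id; exact: closed_openC.
move=> z [_ t01] Kz; have [_] := KQ _ Kz; rewrite /= in_itv /=.
by case: t01 => /= ->; rewrite ltxx ?andbF.
Qed.
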